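(* Let $0<a<b<\infty$, $0<c<d<\infty$, $p,q>-1$ and $\alpha,\beta>0$. Suppose that $f:[a,b]\times[c,d]\to\mathbb{R}$ is continuous and of bounded variation in the sense of Arzelà. Then $$\dim_B\Big(G\big({}^{(p,q)}_{(a,c)}\mathfrak{I}^{(\alpha,\beta)}f\big)\Big)=\dim_H\Big(G\big({}^{(p,q)}_{(a,c)}\mathfrak{I}^{(\alpha,\beta)}f\big)\Big)=2.$$
   Context: For $f:[a,b]\times[c,d]\to\mathbb{R}$ with $0<a<b$, $0<c<d$, real $\alpha,\beta>0$ and $(p,q)\neq(-1,-1)$, the mixed Katugampola fractional integral is $$\big({}^{(p,q)}_{(a,c)}\mathfrak{I}^{(\alpha,\beta)}f\big)(x,y)=\frac{(p+1)^{1-\alpha}(q+1)^{1-\beta}}{\Gamma(\alpha)\Gamma(\beta)}\int_a^x\int_c^y (x^{p+1}-s^{p+1})^{\alpha-1}(y^{q+1}-t^{q+1})^{\beta-1}s^{p}t^{q}f(s,t)\,\mathrm{d}t\,\mathrm{d}s.$$ The graph of $g:[a,b]\times[c,d]\to\mathbb{R}$ is $G(g)=\{(x,y,g(x,y))\}\subset\mathbb{R}^3$; $\dim_H$, $\dim_B$ are Hausdorff and box dimension. Bounded variation in the sense of Arzelà: there is $K$ such that for all $m$ and all $a=x_0\le\dots\le x_m=b$, $c=y_0\le\dots\le y_m=d$, $\sum_{i=0}^{m-1}|f(x_{i+1},y_{i+1})-f(x_i,y_i)|\le K$. *)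

(* Defs.v *)
From HB Require Import structures.
From mathcomp Require Import all_boot all_order all_algebra.
From mathcomp Require Import all_classical all_reals all_analysis.
Set Implicit Arguments. Unset Strict Implicit. Unset Printing Implicit Defensive.
Import Order.TTheory GRing.Theory Num.Theory.
Import numFieldNormedType.Exports.
Local Open Scope classical_set_scope.
Local Open Scope ring_scope.

Section Defs.
Variable R : realType.

Definition Gamma (z : R) : R :=
  Rintegral (@lebesgue_measure R) `]0%R, +oo[
    (fun t => t `^ (z - 1) * expR (- t)).

Definition katugampola (a c p q alpha beta : R) (f : R * R -> R) (z : R * R) : R :=
  let x := z.1 in let y := z.2 in
  ((p + 1) `^ (1 - alpha) * (q + 1) `^ (1 - beta)) / (Gamma alpha * Gamma beta) *
  Rintegral (@lebesgue_measure R) `[a, x]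
    (fun s => Rintegral (@lebesgue_measure R) `[c, y]
      (fun t => (x `^ (p + 1) - s `^ (p + 1)) `^ (alpha - 1) *
                (y `^ (q + 1) - t `^ (q + 1)) `^ (beta - 1) *
                s `^ p * t `^ q * f (s, t))).

Definition arzela_BV (a b c d : R) (f : R * R -> R) : Prop :=
  exists K : R, forall (m : nat) (x y : nat -> R),
    x 0%N = a -> x m = b -> y 0%N = c -> y m = d ->
    (forall i, (i < m)%N -> x i <= x i.+1) ->
    (forall i, (i < m)%N -> y i <= y i.+1) ->
    \sum_(0 <= i < m) `| f (x i.+1, y i.+1) - f (x i, y i) | <= K.

Definition pt3 := (R * R * R)%type.
Definition dist3 (u v : pt3) : R :=
  Num.sqrt ((u.1.1 - v.1.1) ^+ 2 + (u.1.2 - v.1.2) ^+ 2 + (u.2 - v.2) ^+ 2).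

(* Diameter (diam of the empty set is 0). *)
Definition diam3 (U : set pt3) : \bar R :=
  ereal_sup ([set 0%:E] `|` [set (dist3 u v)%:E | u in U & v in U]).

Definition hausdorff_content (s delta : R) (E : set pt3) : \bar R :=
  ereal_inf [set (\sum_(0 <= i <oo) ((fine (diam3 (U i))) `^ s)%:E)%E
            | U in [set U : nat -> set pt3 |
                    E `<=` \bigcup_i U i /\ forall i, (diam3 (U i) <= delta%:E)%E]].

Definition hausdorff_measure (s : R) (E : set pt3) : \bar R :=
  ereal_sup [set hausdorff_content s delta E | delta in `]0%R, +oo[].

Definition dimH (E : set pt3) : \bar R :=
  ereal_inf [set s%:E | s in [set s : R | 0 <= s /\ hausdorff_measure s E = 0%E]].

Definition Ncover (delta : R) (E : set pt3) : \bar R :=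
  ereal_inf [set (n%:R)%:E | n in [set n : nat | exists U : 'I_n -> set pt3,
              E `<=` \bigcup_i U i /\ forall i, (diam3 (U i) <= delta%:E)%E]].

Definition boxdim_is (E : set pt3) (dB : R) : Prop :=
  (forall delta : R, 0 < delta -> (Ncover delta E < +oo)%E) /\
  (fun delta : R => ln (fine (Ncover delta E)) / - ln delta) @ 0^'+ --> dB.

Definition graph3 (a b c d : R) (g : R * R -> R) : set pt3 :=
  [set (z.1, z.2, g z) | z in `[a, b] `*` `[c, d]].

End Defs.

(* Main.v *)
Require Import Defs.
From HB Require Import structures.
From mathcomp Require Import all_boot all_order all_algebra.
From mathcomp Require Import all_classical all_reals all_analysis.
From mathcomp Require Import measurable_realfun ring lra.
Import Order.TTheory GRing.Theory Num.Theory.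
Import numFieldNormedType.Exports.
Local Open Scope classical_set_scope.
Local Open Scope ring_scope.

(** The total variation [V] of an Arzelà-BV function [g] along increasing
    chains satisfies [|g v - g u| <= V v - V u] for [u <= v]. On an [n * n] grid
    the oscillation of [g] on a cell is thus controlled by the increment of [V]
    along its diagonal, and these increments telescope to [O(n)]. Hence
    [O(delta^-2)] sets of diameter [delta] cover the graph. Conversely the graph
    projects onto a rectangle, so the squared diameters of any cover have a sum
    bounded below by its area. Both dimensions are therefore [2].

    The integral is again of Arzelà bounded variation: the substitution
    [r = (x^(p+1) - s^(p+1))^alpha] in each variable makes it a constant times
    the integral of [f (kat_inv x r', kat_inv y r)], where [kat_inv] is
    nondecreasing in the endpoint. Extending the integrand by [0] to a rectangle
    independent of [(x, y)], its increments along a chain of endpoints sum to at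
    most [K + sup |f|] pointwise, and this bound survives integration. *)

Set Implicit Arguments.
Unset Strict Implicit.

(** * Variation along increasing chains *)

(* [V] plays the role of the total variation of [f] along increasing chains
   from [(a, c)]: it turns the Arzelà condition into a telescoping bound. *)
Definition has_variation {R : realType} (a b c d K : R) (f V : R * R -> R) :=
  (forall x y, a <= x -> x <= b -> c <= y -> y <= d -> 0 <= V (x, y) <= K) /\
  (forall x y x' y', a <= x -> x <= x' -> x' <= b ->
     c <= y -> y <= y' -> y' <= d ->
     `|f (x', y') - f (x, y)| <= V (x', y') - V (x, y)).

(** The sums whose supremum is the variation accumulated up to the point [z]; the chains start at
    [(a, c)], end at [z] and may repeat points. *)
Definition chain_sums {R : realType} (a c : R) (f : R * R -> R) (z : R * R) : set R :=
  [set s | exists m (x y : nat -> R),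
    [/\ [/\ x 0%N = a, x m = z.1, y 0%N = c & y m = z.2],
        forall i, (i < m)%N -> x i <= x i.+1,
        forall i, (i < m)%N -> y i <= y i.+1 &
        s = \sum_(0 <= i < m) `|f (x i.+1, y i.+1) - f (x i, y i)|]].

(** A chain ending at [(x, y)] is prolonged by the single point [(x', y')]. This gives both the
    boundedness of the sums and the superadditivity of their supremum. *)
Lemma chain_sums_step {R : realType} (a c : R) (f : R * R -> R) (x y x' y' s : R) :
  x <= x' -> y <= y' -> chain_sums a c f (x, y) s ->
  chain_sums a c f (x', y') (s + `|f (x', y') - f (x, y)|).
Proof.
move=> xx' yy' [m [u [v [[/= u0 um v0 vm] hu hv ->]]]].
pose ext (w : nat -> R) (t : R) i := if (i <= m)%N then w i else t.
have extE w t i : (i <= m)%N -> ext w t i = w i by rewrite /ext => ->.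
have extS w t : ext w t m.+1 = t by rewrite /ext ltnn.
exists m.+1, (ext u x'), (ext v y'); split.
- by rewrite !extS !extE.
- move=> i; rewrite ltnS leq_eqVlt => /predU1P[->|im].
    by rewrite extE// extS um.
  by rewrite !extE ?(ltnW im)//; exact: hu.
- move=> i; rewrite ltnS leq_eqVlt => /predU1P[->|im].
    by rewrite extE// extS vm.
  by rewrite !extE ?(ltnW im)//; exact: hv.
- rewrite big_nat_recr//= !extS !(extE _ _ m)// um vm; congr (_ + _).
  by apply: eq_big_nat => i /andP[_ im]; rewrite !extE// ltnW.
Qed.

(** [V z] is the supremum of the chain sums ending at [z]. Each such chain prolongs to [(b, d)], so
    its sum is at most the Arzelà constant; prolonging from [u] to [v] yields the increment
    bound. *)
Lemma arzela_BV_variation {R : realType} (a b c d : R) (f : R * R -> R) :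
  a <= b -> c <= d -> arzela_BV a b c d f ->
  exists K V, has_variation a b c d K f V.
Proof.
move=> ab cd [K hK].
have ubK z : z.1 <= b -> z.2 <= d -> ubound (chain_sums a c f z) K.
  case: z => x y /= xb yd s hs.
  have [m [u [v [[/= u0 um v0 vm] hu hv sE]]]] := chain_sums_step xb yd hs.
  have := hK m u v u0 um v0 vm hu hv; rewrite -sE.
  by apply: le_trans; rewrite lerDl.
have ne x y : a <= x -> c <= y -> chain_sums a c f (x, y) `|f (x, y) - f (a, c)|.
  move=> ax cy; rewrite -[X in chain_sums _ _ _ _ X]add0r.
  apply: chain_sums_step => //.
  by exists 0%N, (fun=> a), (fun=> c); split=> //; rewrite big_nil.
have hs x y : a <= x -> x <= b -> c <= y -> y <= d ->
    has_sup (chain_sums a c f (x, y)).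
  by move=> ax xb cy yd; split; [exists `|f (x, y) - f (a, c)|; exact: ne|
    exists K; exact: ubK].
exists K, (fun z => sup (chain_sums a c f z)); split.
- move=> x y ax xb cy yd; apply/andP; split.
    apply: le_trans (ub_le_sup (hs _ _ ax xb cy yd).2 (ne _ _ ax cy)).
    exact: normr_ge0.
  by apply: ge_sup; [exact: (hs _ _ ax xb cy yd).1|exact: ubK].
- move=> x y x' y' ax xx' xb cy yy' yd.
  rewrite lerBrDr addrC -lerBrDr.
  apply: ge_sup.
    by apply: (hs _ _ ax (le_trans xx' xb) cy (le_trans yy' yd)).1.
  move=> s ss; rewrite lerBrDr; apply: ub_le_sup.
    exact: (hs _ _ (le_trans ax xx') xb (le_trans cy yy') yd).2.
  exact: chain_sums_step.
Qed.

Lemma has_variation_bounded {R : realType} (a b c d K : R) (f V : R * R -> R) :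
  a <= b -> c <= d -> has_variation a b c d K f V ->
  exists M, forall x y, a <= x -> x <= b -> c <= y -> y <= d -> `|f (x, y)| <= M.
Proof.
move=> ab cd [hV hf]; exists (`|f (a, c)| + K).
move=> x y ax xb cy yd.
have := hf a c x y (lexx _) ax xb (lexx _) cy yd.
have /andP[_] := hV x y ax xb cy yd.
have /andP[+ _] := hV a c (lexx _) ab (lexx _) cd.
have := lerB_dist (f (x, y)) (f (a, c)); lra.
Qed.

(** * Covers of the graph *)

Lemma diam3_le {R : realType} (U : set (pt3 R)) (delta : R) : 0 <= delta ->
  (forall u v, U u -> U v -> dist3 u v <= delta) -> (diam3 U <= delta%:E)%E.
Proof.
move=> d0 h; apply: ge_ereal_sup => r [->|]; first by rewrite lee_fin.
by move=> [u Uu [v Uv <-]]; rewrite lee_fin h.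
Qed.

(** Three coordinate differences of at most [delta / 2] have squares summing to at most
    [3/4 * delta ^+ 2]. *)
Lemma dist3_le {R : realType} (u v : pt3 R) (delta : R) : 0 <= delta ->
  `|u.1.1 - v.1.1| <= delta / 2 -> `|u.1.2 - v.1.2| <= delta / 2 ->
  `|u.2 - v.2| <= delta / 2 -> dist3 u v <= delta.
Proof.
move=> d0; have sq (t : R) : `|t| <= delta / 2 -> t ^+ 2 <= delta ^+ 2 / 4.
  rewrite ler_norml -subr_ge0 -[t <= _]subr_ge0 => /andP[h1 h2].
  by have := mulr_ge0 h1 h2; lra.
move=> /sq h1 /sq h2 /sq h3.
rewrite /dist3 -[leRHS]ger0_norm// -sqrtr_sqr ler_wsqrtr//.
have := sqr_ge0 delta; lra.
Qed.

(** Allows covers indexed by any finite type, in particular by pairs of a grid cell and a layer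
    above it. *)
Lemma Ncover_fin {R : realType} (T : finType) (U : T -> set (pt3 R))
    (E : set (pt3 R)) (delta : R) :
  E `<=` \bigcup_i U i -> (forall i, (diam3 (U i) <= delta%:E)%E) ->
  (Ncover delta E <= (#|T|%:R)%:E)%E.
Proof.
move=> hE hU; apply: ereal_inf_lbound; exists #|T| => //.
exists (U \o enum_val); split; last by move=> i; exact: hU.
move=> z /hE[t _ Utz]; exists (enum_rank t) => //=.
by rewrite enum_rankK.
Qed.

Lemma grid_locate {R : realType} (n : nat) (h t : R) : (0 < n)%N -> 0 < h ->
  0 <= t -> t <= n%:R * h -> exists i : 'I_n, i%:R * h <= t <= i.+1%:R * h.
Proof.
case: n => // n _ h0 t0 tn.
have th0 : 0 <= t / h by rewrite divr_ge0// ltW.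
have /andP[k1 k2] := truncn_itv th0.
have [kn|nk] := ltnP (Num.truncn (t / h)) n.+1.
  exists (Ordinal kn) => /=; rewrite -ler_pdivlMr// k1/=.
  by rewrite -ler_pdivrMr// ltW.
(* Here [t / h] is at least the number of cells, so [t] is the right end of the last one. *)
exists ord_max => /=; rewrite tn andbT -ler_pdivlMr//.
by apply: le_trans k1; rewrite ler_nat ltnW.
Qed.

(** A diagonal increment is a step in [i] at height [j.+1] plus a step in [j] at abscissa [i]. The
    former telescope along rows, the latter along columns, leaving [2 n] differences of at most
    [K]. *)
Lemma sum_diag_increments {R : realType} (n : nat) (K : R) (v : nat -> nat -> R) :
  (forall i j, (i <= n)%N -> (j <= n)%N -> 0 <= v i j <= K) ->
  \sum_(i < n) \sum_(j < n) (v i.+1 j.+1 - v i j) <= n%:R * K *+ 2.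
Proof.
move=> hv.
have -> : \sum_(i < n) \sum_(j < n) (v i.+1 j.+1 - v i j) =
    \sum_(j < n) (v n j.+1 - v 0%N j.+1) + \sum_(i < n) (v i n - v i 0%N).
  have -> : \sum_(j < n) (v n j.+1 - v 0%N j.+1) =
      \sum_(j < n) \sum_(i < n) (v i.+1 j.+1 - v i j.+1).
    apply: eq_bigr => j _; rewrite -(big_mkord xpredT (fun i => v i.+1 j.+1 - v i j.+1)).
    by rewrite telescope_sumr.
  rewrite [X in _ = X + _]exchange_big -big_split/=; apply: eq_bigr => i _.
  have -> : v i n - v i 0%N = \sum_(j < n) (v i j.+1 - v i j).
    by rewrite -(big_mkord xpredT (fun j => v i j.+1 - v i j)) telescope_sumr.
  by rewrite -big_split/=; apply: eq_bigr => j _; ring.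
have sumK : \sum_(i < n) K = n%:R * K.
  by rewrite big_const_ord iter_addr_0 mulr_natl.
rewrite mulr2n -sumK lerD//; apply: ler_sum => i _.
- have /andP[_ h1] := hv n i.+1 (leqnn _) (ltn_ord i).
  by have /andP[+ _] := hv 0%N i.+1 (leq0n _) (ltn_ord i); lra.
- have /andP[_ h1] := hv i n (ltnW (ltn_ord i)) (leqnn _).
  by have /andP[+ _] := hv i 0%N (ltnW (ltn_ord i)) (leq0n _); lra.
Qed.

Lemma step_dist {R : realType} (l h m s t : R) :
  l <= s <= l + h -> l <= t <= l + h -> h <= m -> `|s - t| <= m.
Proof. by rewrite ler_norml; lra. Qed.

(** Over a cell with diagonal increment [w] the graph stays in a column of height [2 w], cut into at
    most [4 w / e + 1] boxes of height [e / 2]. As the [w] sum to at most [2 n K] and [n] is of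
    order [1 / e], the number of boxes is of order [1 / e ^+ 2]. *)
Lemma Ncover_graph_le {R : realType} (a b c d K : R) (g V : R * R -> R) :
  a < b -> c < d -> has_variation a b c d K g V ->
  exists C : R, 0 < C /\ forall delta : R, 0 < delta -> delta <= 1 ->
    (Ncover delta (graph3 a b c d g) <= (C / delta ^+ 2)%:E)%E.
Proof.
move=> ab cd [hV hg].
pose L := (b - a) + (d - c).
have L0 : 0 < L by rewrite /L; lra.
have K0 : 0 <= K.
  by have /andP[] := hV a c (lexx _) (ltW ab) (lexx _) (ltW cd); exact: le_trans.
(* This is [e ^+ 2] times [4 / e * (2 n K) + n ^+ 2] at the upper bound [(2 * L + 1) / e] for
   [n]. *)
exists (8 * K * (2 * L + 1) + (2 * L + 1) ^+ 2); split.
  by rewrite ltr_wpDl ?exprn_gt0 ?mulr_ge0//; lra.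
move=> e e0 e1.
(* Chosen so that both mesh widths are at most [e / 2]. *)
pose n := (Num.truncn (2 * L / e)).+1.
have n0 : 0 < n%:R :> R by rewrite ltr0n.
have eL0 : 0 <= 2 * L / e by rewrite divr_ge0 ?mulr_ge0// ltW.
have nL : 2 * L / e <= n%:R by have /andP[_ /ltW] := truncn_itv eL0.
have nU : n%:R <= (2 * L + 1) / e.
  have /andP[h _] := truncn_itv eL0.
  rewrite /n -[X in X <= _]natr1 [leRHS]mulrDl lerD// mul1r.
  by rewrite invf_ge1.
pose hx := (b - a) / n%:R; pose hy := (d - c) / n%:R.
have hx0 : 0 < hx by rewrite divr_gt0// subr_gt0.
have hy0 : 0 < hy by rewrite divr_gt0// subr_gt0.
have nLe : L <= n%:R * (e / 2).
  move: nL; rewrite ler_pdivrMr// => nL.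
  by rewrite mulrA ler_pdivlMr//; lra.
have hxe : hx <= e / 2 by rewrite ler_pdivrMr// mulrC; rewrite /L in nLe; lra.
have hye : hy <= e / 2 by rewrite ler_pdivrMr// mulrC; rewrite /L in nLe; lra.
have nhx : n%:R * hx = b - a by rewrite mulrC divfK// gt_eqF.
have nhy : n%:R * hy = d - c by rewrite mulrC divfK// gt_eqF.
pose x (i : nat) := a + i%:R * hx; pose y (j : nat) := c + j%:R * hy.
have xn : x n = b by rewrite /x nhx; lra.
have yn : y n = d by rewrite /y nhy; lra.
have stepS (k : nat) (h : R) : k.+1%:R * h = k%:R * h + h.
  by rewrite -natr1 mulrDl mul1r.
have xS i : x i.+1 = x i + hx by rewrite /x stepS addrA.
have yS i : y i.+1 = y i + hy by rewrite /y stepS addrA.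
have xle i j : (i <= j)%N -> x i <= x j.
  by move=> ij; rewrite /x lerD2l ler_wpM2r ?ler_nat// ltW.
have yle i j : (i <= j)%N -> y i <= y j.
  by move=> ij; rewrite /y lerD2l ler_wpM2r ?ler_nat// ltW.
have x0 : x 0%N = a by rewrite /x mul0r addr0.
have y0 : y 0%N = c by rewrite /y mul0r addr0.
have xa i : a <= x i by rewrite -x0 xle.
have yc i : c <= y i by rewrite -y0 yle.
have xb i : (i <= n)%N -> x i <= b by rewrite -xn; exact: xle.
have yd i : (i <= n)%N -> y i <= d by rewrite -yn; exact: yle.
pose w (ij : 'I_n * 'I_n) := V (x ij.1.+1, y ij.2.+1) - V (x ij.1, y ij.2).
have w0 ij : 0 <= w ij.
  apply: le_trans (hg _ _ _ _ (xa _) (xle _ _ (leqnSn _)) (xb _ (ltn_ord _))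
    (yc _) (yle _ _ (leqnSn _)) (yd _ (ltn_ord _))).
  exact: normr_ge0.
pose N ij := (Num.truncn (4 * w ij / e)).+1.
pose lo (ij : 'I_n * 'I_n) := g (x ij.1, y ij.2) - w ij.
(* A box is indexed by a cell and a layer; layers are counted upwards from [lo], a lower bound for
   [g] on the cell. *)
pose box (t : {ij : 'I_n * 'I_n & 'I_(N ij)}) : set (pt3 R) :=
  [set u | [/\ x (tag t).1 <= u.1.1 <= x (tag t).1.+1,
               y (tag t).2 <= u.1.2 <= y (tag t).2.+1 &
               (tagged t)%:R * (e / 2) <= u.2 - lo (tag t)
                 <= (tagged t).+1%:R * (e / 2)]].
apply: (@le_trans _ _ (#|{: {ij : 'I_n * 'I_n & 'I_(N ij)}}|%:R)%:E).
  apply: (@Ncover_fin _ _ box).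
  - move=> _ [[s t] [/= + + <-]]; rewrite !in_itv/= => /andP[as_ sb] /andP[ct td].
    have [i /andP[i1 i2]] : exists i : 'I_n, i%:R * hx <= s - a <= i.+1%:R * hx.
      by apply: grid_locate => //; rewrite ?nhx; lra.
    have [j /andP[j1 j2]] : exists j : 'I_n, j%:R * hy <= t - c <= j.+1%:R * hy.
      by apply: grid_locate => //; rewrite ?nhy; lra.
    have xi1 : x i <= s by rewrite /x; lra.
    have xi2 : s <= x i.+1 by rewrite /x; lra.
    have yj1 : y j <= t by rewrite /y; lra.
    have yj2 : t <= y j.+1 by rewrite /y; lra.
    have h1 := hg _ _ _ _ (xa i) xi1 sb (yc j) yj1 td.
    have h2 := hg _ _ _ _ as_ xi2 (xb _ (ltn_ord i)) ct yj2 (yd _ (ltn_ord j)).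
    (* [V] increases from the lower left corner through [(s, t)] to the upper right corner, so the
       whole diagonal increment dominates. *)
    have h3 : `|g (s, t) - g (x i, y j)| <= w (i, j).
      apply: le_trans h1 _; rewrite /w/= lerD2r.
      by rewrite -subr_ge0; apply: le_trans h2.
    have {h1 h2 h3} : 0 <= g (s, t) - lo (i, j) <= 2 * w (i, j).
      by move: h3; rewrite ler_norml /lo/=; lra.
    move=> /andP[k1 k2].
    have [k hk] : exists k : 'I_(N (i, j)),
        k%:R * (e / 2) <= g (s, t) - lo (i, j) <= k.+1%:R * (e / 2).
      apply: grid_locate => //; first by rewrite divr_gt0.
      apply: le_trans k2 _; rewrite mulrA ler_pdivlMr//.
      have p0 : 0 <= 4 * w (i, j) / e by rewrite divr_ge0 ?mulr_ge0// ltW.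
      have /andP[_ /ltW] := truncn_itv p0.
      by rewrite -/(N (i, j)) ler_pdivrMr//; lra.
    exists (@Tagged _ (i, j) (fun ij => 'I_(N ij)) k) => //=.
    by split; rewrite ?xi1 ?yj1.
  - move=> t; apply: diam3_le; first exact: ltW.
    move=> u v [u1 u2 u3] [v1 v2 v3].
    rewrite xS in u1 v1; rewrite yS in u2 v2; rewrite stepS in u3 v3.
    apply: dist3_le; [exact: ltW|exact: step_dist u1 v1 hxe|
      exact: step_dist u2 v2 hye|].
    have := step_dist u3 v3 (lexx _); congr (`|_| <= _); ring.
rewrite lee_fin card_tagged.
have -> : sumn [seq #|'I_(N i)| | i <- enum {: 'I_n * 'I_n}] =
    \sum_(ij : 'I_n * 'I_n) N ij.
  rewrite sumnE big_map big_enum/=.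
  by apply: eq_bigr => ij _; rewrite card_ord.
rewrite natr_sum.
apply: (@le_trans _ _ (\sum_(ij : 'I_n * 'I_n) (4 / e * w ij + 1))).
  apply: ler_sum => ij _; rewrite /N -natr1 lerD2r.
  have p0 : 0 <= 4 * w ij / e by rewrite divr_ge0 ?mulr_ge0// ltW.
  by have /andP[+ _] := truncn_itv p0; rewrite mulrAC.
rewrite big_split/= -mulr_sumr.
have -> : \sum_(ij : 'I_n * 'I_n) w ij =
    \sum_(i < n) \sum_(j < n) (V (x i.+1, y j.+1) - V (x i, y j)).
  by rewrite pair_big.
have hVn i j : (i <= n)%N -> (j <= n)%N -> 0 <= V (x i, y j) <= K.
  by move=> ni nj; apply: hV; rewrite ?xa ?yc ?xb ?yd.
have hS := sum_diag_increments hVn.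
have -> : \sum_(i : 'I_n * 'I_n) (1 : R) = n%:R * n%:R.
  by rewrite sumr_const card_prod card_ord natrM.
have e2 : 0 < e^-1 by rewrite invr_gt0.
apply: (@le_trans _ _ (4 / e * (n%:R * K *+ 2) + n%:R * n%:R)).
  by rewrite lerD2r ler_wpM2l// divr_ge0// ltW.
have -> : (8 * K * (2 * L + 1) + (2 * L + 1) ^+ 2) / e ^+ 2 =
   4 / e * (((2 * L + 1) / e) * K *+ 2) + ((2 * L + 1) / e) * ((2 * L + 1) / e).
  by field; rewrite gt_eqF.
apply: lerD.
  by rewrite ler_wpM2l ?divr_ge0 ?(ltW e0)// lerMn2r/= ler_wpM2r.
by apply: ler_pM => //; exact: ltW.
Qed.

(** * Area bound for covers of the graph *)

Lemma normB_le_dist3 {R : realType} (u v : pt3 R) :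
  `|u.1.1 - v.1.1| <= dist3 u v /\ `|u.1.2 - v.1.2| <= dist3 u v.
Proof.
rewrite -!sqrtr_sqr /dist3; split; rewrite ler_wsqrtr// -?addrA.
  by rewrite lerDl addr_ge0// sqr_ge0.
by rewrite addrCA lerDl addr_ge0// sqr_ge0.
Qed.

Lemma diam3_ge0 {R : realType} (U : set (pt3 R)) : (0 <= diam3 U)%E.
Proof. by apply: ereal_sup_ubound; left. Qed.

Lemma diam3_set0 {R : realType} : diam3 (set0 : set (pt3 R)) = 0%E.
Proof.
by apply/eqP; rewrite eq_le diam3_ge0 andbT; exact: diam3_le.
Qed.

Lemma dist3_le_diam3 {R : realType} (U : set (pt3 R)) (u v : pt3 R) :
  (diam3 U < +oo)%E -> U u -> U v -> dist3 u v <= fine (diam3 U).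
Proof.
move=> fU Uu Uv; rewrite -lee_fin fineK ?ge0_fin_numE ?diam3_ge0//.
by apply: ereal_sup_ubound; right; exists u => //; exists v.
Qed.

(* The projection to the plane is 1-Lipschitz, so a set of diameter [r]
   projects into a square of side [2 r]. *)
Lemma area_le_cover {R : realType} (a b c d : R) (g : R * R -> R)
    (U : nat -> set (pt3 R)) :
  a < b -> c < d -> graph3 a b c d g `<=` \bigcup_i U i ->
  (forall i, (diam3 (U i) < +oo)%E) ->
  (((b - a) * (d - c))%:E <=
   \sum_(0 <= i <oo) (4 * fine (diam3 (U i)) ^+ 2)%:E)%E.
Proof.
move=> ab cd hU fU.
pose mu : {sigma_finite_measure set (measurableTypeR R) -> \bar R} :=
  lebesgue_measure.
pose r i := fine (diam3 (U i)).
have r0 i : 0 <= r i by rewrite fine_ge0// diam3_ge0.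
pose sq i (u : pt3 R) : set (measurableTypeR R * measurableTypeR R) :=
  `[u.1.1 - r i, u.1.1 + r i] `*` `[u.1.2 - r i, u.1.2 + r i].
have msq i u : measurable (sq i u) by apply: measurableX; exact: measurable_itv.
have muI (x y : R) : x <= y -> mu `[x, y]%classic = (y - x)%:E.
  move=> xy; rewrite /mu/= lebesgue_measure_itv/= lte_fin.
  by case: ltP => // yx; have -> : x = y by [apply/eqP; rewrite eq_le xy];
    rewrite subrr.
have mubox (x x' y y' : R) : x <= x' -> y <= y' ->
    (mu \x mu)%E (`[x, x']%classic `*` `[y, y']%classic) =
    ((x' - x) * (y' - y))%:E.
  move=> xx' yy'; rewrite EFinM -(muI _ _ xx') -(muI _ _ yy').
  by apply: product_measure1E; exact: measurable_itv.
have musq i u : (mu \x mu)%E (sq i u) = (4 * r i ^+ 2)%:E.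
  have rr t : t - r i <= t + r i by have := r0 i; lra.
  by rewrite /sq mubox ?rr//; apply: congr1; ring.
pose u0 i := xget point (U i).
(* An empty [U i] has no point to serve as centre and receives the empty set instead of a square. *)
pose B i := if pselect (U i !=set0) then sq i (u0 i) else set0.
have mB i : measurable (B i).
  by rewrite /B; case: pselect => [w|w] /=; [exact: msq|exact: measurable0].
have UB i u : U i u -> B i u.1.
  move=> Uu; rewrite /B; case: pselect => [w|w] /=; last by case: w; exists u.
  have Uu0 : U i (u0 i) by exact: (xgetI point Uu).
  have [h1 h2] := normB_le_dist3 u (u0 i).
  have := dist3_le_diam3 (fU i) Uu Uu0; rewrite -/(r i) => hr.
  move: (le_trans h1 hr) (le_trans h2 hr); rewrite !ler_norml => k1 k2.
  by split; rewrite /= in_itv/=; lra.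
have muB i : ((mu \x mu) (B i) <= (4 * r i ^+ 2)%:E)%E.
  rewrite /B; case: pselect => w /=; first by rewrite musq.
  by rewrite measure0 lee_fin mulr_ge0// sqr_ge0.
rewrite -(mubox _ _ _ _ (ltW ab) (ltW cd)).
apply: le_trans (@measure_sigma_subadditive _ _ _ (mu \x mu)%E _ B mB _ _) _.
- by apply: measurableX; exact: measurable_itv.
- move=> z hz; have [|i _ Uz] := hU (z.1, z.2, g z); first by exists z.
  by exists i => //; have := UB _ _ Uz; rewrite -surjective_pairing.
- by apply: lee_nneseries => i *; [exact: measure_ge0|exact: muB].
Qed.

(** Turns a finite cover into a sequence by appending empty sets, whose diameter is [0], so that
    bounds for countable covers apply. *)
Definition pad {T : Type} n (U : 'I_n -> set T) (i : nat) : set T :=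
  if insub i is Some j then U j else set0.

Lemma pad_ge {T : Type} n (U : 'I_n -> set T) i : (n <= i)%N -> pad U i = set0.
Proof. by move=> ni; rewrite /pad insubF// ltnNge ni. Qed.

Lemma bigcup_pad {T : Type} n (U : 'I_n -> set T) :
  \bigcup_i U i `<=` \bigcup_i pad U i.
Proof. by move=> z [i _ Uz]; exists (i : nat) => //; rewrite /pad valK. Qed.

Lemma diam3_pad_le {R : realType} n (U : 'I_n -> set (pt3 R)) (delta : \bar R) i :
  (0 <= delta)%E -> (forall j, (diam3 (U j) <= delta)%E) ->
  (diam3 (pad U i) <= delta)%E.
Proof. by move=> d0 hU; rewrite /pad; case: insub => // ; rewrite diam3_set0. Qed.

Lemma nneseries_le_finite {R : realType} (f : nat -> \bar R) (x : R) n :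
  (forall i, 0 <= f i)%E -> (forall i, (n <= i)%N -> f i = 0%E) ->
  (forall i, f i <= x%:E)%E ->
  (\sum_(0 <= i <oo) f i <= (n%:R * x)%:E)%E.
Proof.
move=> f0 fn fx; rewrite (nneseries_split 0 n)// add0n.
rewrite [X in (_ + X)%E]eseries0 ?adde0; last by move=> i ni _; exact: fn.
apply: le_trans (lee_sum _ (fun i _ => fx i)) _.
by rewrite sumEFin sumr_const_nat subn0 mulr_natl.
Qed.

Lemma fine_diam3_le {R : realType} (U : set (pt3 R)) (delta : R) :
  (diam3 U <= delta%:E)%E -> fine (diam3 U) <= delta.
Proof.
move=> hU; rewrite -lee_fin fineK// ge0_fin_numE ?diam3_ge0//.
exact: le_lt_trans hU (ltry _).
Qed.

(** For [n] covering sets of diameter at most [delta], the area of the rectangle is at most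
    [n * 4 * delta ^+ 2]. *)
Lemma Ncover_graph_ge {R : realType} (a b c d : R) (g : R * R -> R) (delta : R) :
  a < b -> c < d -> 0 < delta ->
  (((b - a) * (d - c) / 4 / delta ^+ 2)%:E <= Ncover delta (graph3 a b c d g))%E.
Proof.
move=> ab cd d0; apply/ereal_infP => _ [n [U [GU hU]] <-].
rewrite lee_fin !ler_pdivrMr ?exprn_gt0// -lee_fin.
have hV i := @diam3_pad_le _ _ U delta%:E i (ltW d0) hU.
apply: le_trans (area_le_cover ab cd (subset_trans GU (@bigcup_pad _ _ U)) _) _.
  by move=> i; apply: le_lt_trans (hV i) (ltry _).
rewrite -mulrA [_ * 4]mulrC; apply: nneseries_le_finite => i.
- by rewrite lee_fin mulr_ge0// sqr_ge0.
- by move=> ni; rewrite pad_ge// diam3_set0 expr0n mulr0.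
- rewrite lee_fin ler_wpM2l// lerXn2r ?nnegrE ?fine_ge0 ?diam3_ge0 ?(ltW d0)//.
  exact: fine_diam3_le.
Qed.

(** * Box and Hausdorff dimension of the graph *)

Lemma Ncover_le {R : realType} (E : set (pt3 R)) (d1 d2 : R) : d1 <= d2 ->
  (Ncover d2 E <= Ncover d1 E)%E.
Proof.
move=> d12; apply: le_ereal_inf => _ [n [U [hE hU]] <-]; exists n => //.
by exists U; split=> // i; apply: le_trans (hU i) _; rewrite lee_fin.
Qed.

(** The covering number lies between [A / h ^+ 2] and [C / h ^+ 2], so its logarithm differs from
    [- 2 ln h] by a bounded amount, which is negligible after division by [- ln h]. *)
Lemma boxdim_graph {R : realType} (a b c d K : R) (g V : R * R -> R) :
  a < b -> c < d -> has_variation a b c d K g V ->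
  boxdim_is (graph3 a b c d g) 2.
Proof.
move=> ab cd hV; have [C [C0 hC]] := Ncover_graph_le ab cd hV.
set G := graph3 _ _ _ _ _.
have fin (e : R) : 0 < e -> (Ncover e G < +oo)%E.
  (* The upper bound holds at scales up to [1]; larger scales follow by monotonicity. *)
  move=> e0; apply: (@le_lt_trans _ _ (Ncover (Num.min e 1) G)).
    by apply: Ncover_le; rewrite ge_min lexx.
  have m0 : 0 < Num.min e 1 by rewrite lt_min e0 ltr01.
  have m1 : Num.min e 1 <= 1 by rewrite ge_min lexx orbT.
  exact: le_lt_trans (hC _ m0 m1) (ltry _).
split=> //; set A := (b - a) * (d - c) / 4.
have A0 : 0 < A by rewrite divr_gt0// mulr_gt0// subr_gt0.
pose M := `|ln A| + `|ln C|.
have M0 : 0 <= M by rewrite addr_ge0.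
apply/cvgrPdist_le => /= e e0; near=> h.
have h0 : 0 < h by near: h; exact: nbhs_right_gt.
have h1 : h < 1 by near: h; exact: nbhs_right_lt.
(* Equivalent to [h <= expR (- (M / e))], which holds near [0]. *)
have hM : M / e <= - ln h.
  rewrite lerNr -ler_expR lnK ?posrE//; apply: ltW.
  by near: h; apply: nbhs_right_lt; exact: expR_gt0.
have lh : 0 < - ln h by rewrite oppr_gt0 ln_lt0// h0 h1.
have e2 : 0 < h ^+ 2 by rewrite exprn_gt0.
have NE : (Ncover h G = (fine (Ncover h G))%:E)%E.
  rewrite fineK// ge0_fin_numE ?fin//.
  apply: le_trans (Ncover_graph_ge g ab cd h0).
  by rewrite lee_fin divr_ge0// ltW.
have NA : A / h ^+ 2 <= fine (Ncover h G).
  by rewrite -lee_fin -NE; exact: Ncover_graph_ge.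
have NC : fine (Ncover h G) <= C / h ^+ 2.
  by rewrite -lee_fin -NE; apply: hC => //; exact: ltW.
have p1 : 0 < A / h ^+ 2 by rewrite divr_gt0.
have N0 : 0 < fine (Ncover h G) by exact: lt_le_trans NA.
have q (X : R) : 0 < X -> ln (X / h ^+ 2) = ln X - ln h *+ 2.
  by move=> X0; rewrite ln_div ?posrE// lnXn.
have l1 : ln A - ln h *+ 2 <= ln (fine (Ncover h G)).
  by rewrite -q// ler_ln ?posrE.
have l2 : ln (fine (Ncover h G)) <= ln C - ln h *+ 2.
  by rewrite -q// ler_ln ?posrE// divr_gt0.
have -> : 2 - ln (fine (Ncover h G)) / - ln h =
   (ln h *- 2 - ln (fine (Ncover h G))) / - ln h.
  by rewrite mulrBl; congr (_ - _); rewrite -mulNrn mulrnAl divff// gt_eqF.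
rewrite normrM normfV (gtr0_norm lh) ler_pdivrMr//.
move: hM; rewrite ler_pdivrMr// [_ * e]mulrC; apply: le_trans.
rewrite ler_norml /M.
have a1 := ler_norm (- ln A); have a2 := ler_norm (ln C); rewrite normrN in a1.
have a3 := normr_ge0 (ln A); have a4 := normr_ge0 (ln C).
by lra.
Unshelve. all: by end_near. Qed.

Lemma hausdorff_measure_graph_eq0 {R : realType} (a b c d K s : R)
    (g V : R * R -> R) :
  a < b -> c < d -> has_variation a b c d K g V -> 2 < s ->
  hausdorff_measure s (graph3 a b c d g) = 0%E.
Proof.
move=> ab cd hV s2; have [C [C0 hC]] := Ncover_graph_le ab cd hV.
have content0 delta : 0 < delta -> hausdorff_content s delta (graph3 a b c d g) = 0%E.
  move=> d0; apply/eqP; rewrite eq_le; apply/andP; split; last first.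
    apply/ereal_infP => _ [U _ <-]; apply: nneseries_ge0 => i _ _.
    by rewrite lee_fin powR_ge0.
  apply/lee_addgt0Pr => e e0; rewrite add0e.
  pose r : R := Num.min (Num.min delta 1) ((e / (C + 1)) `^ (s - 2)^-1).
  have eC : 0 < e / (C + 1) by rewrite divr_gt0// addr_gt0.
  have r0 : 0 < r by rewrite !lt_min d0 powR_gt0// ltr01.
  have rd : r <= delta by rewrite !ge_min lexx.
  have r1 : r <= 1 by rewrite !ge_min lexx orbT.
  have re : r <= (e / (C + 1)) `^ (s - 2)^-1 by rewrite ge_min lexx orbT.
  have r2 : 0 < r ^+ 2 by rewrite exprn_gt0.
  (* The slack [1] makes the inequality strict, so an actual cover can be extracted from the
     infimum. *)
  have lt1 : (Ncover r (graph3 a b c d g) < (C / r ^+ 2 + 1)%:E)%E.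
    by apply: le_lt_trans (hC _ r0 r1) _; rewrite lte_fin ltrDl.
  have [_ [n [U [GU hU]] <-]] := ereal_inf_lt lt1.
  rewrite lte_fin => /ltW hn.
  have hW i := @diam3_pad_le _ _ U r%:E i (ltW r0) hU.
  apply: ge_ereal_inf; exists (\sum_(0 <= i <oo) ((fine (diam3 (pad U i))) `^ s)%:E)%E.
    exists (pad U) => //; split; first exact: subset_trans GU (@bigcup_pad _ _ U).
    by move=> i; apply: le_trans (hW i) _; rewrite lee_fin.
  apply: (@le_trans _ _ (n%:R * r `^ s)%:E).
    apply: nneseries_le_finite => i.
    - by rewrite lee_fin powR_ge0.
    - by move=> ni; rewrite pad_ge// diam3_set0 powR0// gt_eqF//; lra.
    - rewrite lee_fin ge0_ler_powR ?nnegrE ?fine_ge0 ?diam3_ge0 ?(ltW r0)//; first by lra.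
      exact: fine_diam3_le.
  rewrite lee_fin.
  have rs : r `^ s = r ^+ 2 * r `^ (s - 2).
    rewrite -powR_mulrn ?(ltW r0)// -powRD ?(gt_eqF r0) ?implybT//.
    by congr (_ `^ _); ring.
  have rse : r `^ (s - 2) <= e / (C + 1).
    have s20 : 0 < s - 2 by rewrite subr_gt0.
    have := @ge0_ler_powR _ (s - 2) (ltW s20) r _ _ _ re.
    rewrite !nnegrE powR_ge0 (ltW r0) -powRrM mulVf ?gt_eqF//.
    by rewrite powRr1 ?(ltW eC)//; exact.
    apply: (@le_trans _ _ ((C / r ^+ 2 + 1) * r `^ s)).
    by rewrite ler_wpM2r// powR_ge0.
  rewrite rs mulrA mulrDl divfK ?gt_eqF// mul1r.
  apply: (@le_trans _ _ ((C + 1) * r `^ (s - 2))).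
    by rewrite ler_wpM2r ?powR_ge0// lerD2l expr_le1// ltW.
  by rewrite mulrC -ler_pdivlMr// addr_gt0.
apply/eqP; rewrite eq_le; apply/andP; split.
  by apply: ge_ereal_sup => x [e]; rewrite /= in_itv/= andbT => e0 <-; rewrite content0.
apply: ereal_sup_ubound; exists 1; last exact: content0.
by rewrite /= in_itv/= ltr01.
Qed.

Lemma hausdorff_measure_graph_gt0 {R : realType} (a b c d s : R) (g : R * R -> R) :
  a < b -> c < d -> s < 2 -> (0 < hausdorff_measure s (graph3 a b c d g))%E.
Proof.
move=> ab cd s2.
have A0 : 0 < (b - a) * (d - c) / 4 by rewrite divr_gt0// mulr_gt0// subr_gt0.
apply: (@lt_le_trans _ _ ((b - a) * (d - c) / 4)%:E); first by rewrite lte_fin.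
apply: (@le_trans _ _ (hausdorff_content s 1 (graph3 a b c d g))); last first.
  by apply: ereal_sup_ubound; exists 1 => //; rewrite /= in_itv/= ltr01.
apply/ereal_infP => _ [U [GU hU] <-].
rewrite mulrC EFinM lee_pdivrMl//.
apply: le_trans (area_le_cover ab cd GU _) _.
  by move=> i; apply: le_lt_trans (hU i) (ltry _).
rewrite -nneseriesZl; last by move=> i _; rewrite lee_fin powR_ge0.
apply: lee_nneseries => i *; first by rewrite lee_fin mulr_ge0// sqr_ge0.
rewrite -EFinM lee_fin ler_wpM2l//.
(* Monotonicity in the exponent requires a positive base; diameter [0] is settled apart. *)
have [->|r0] := eqVneq (fine (diam3 (U i))) 0; first by rewrite expr0n powR_ge0.
have r_ge0 : 0 <= fine (diam3 (U i)) by rewrite fine_ge0// diam3_ge0.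
rewrite -powR_mulrn// ger_powR ?(ltW s2)// fine_diam3_le// andbT.
by rewrite lt_neqAle eq_sym r0.
Qed.

Lemma dimH_graph {R : realType} (a b c d K : R) (g V : R * R -> R) :
  a < b -> c < d -> has_variation a b c d K g V ->
  dimH (graph3 a b c d g) = 2%:E.
Proof.
move=> ab cd hV; apply/eqP; rewrite eq_le; apply/andP; split.
  apply/lee_addgt0Pr => e e0; apply: ereal_inf_lbound; exists (2 + e) => //.
  split; first by lra.
  by apply: hausdorff_measure_graph_eq0 hV _ => //; lra.
apply/ereal_infP => _ [s [s0 hs] <-]; rewrite lee_fin leNgt; apply/negP => s2.
by have := hausdorff_measure_graph_gt0 g ab cd s2; rewrite hs ltxx.
Qed.

(** * The substitution *)

Section Substitution.
Context {R : realType}.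
Notation mu := (@lebesgue_measure R).
Variables (p alpha x : R).
Hypotheses (p1 : -1 < p) (alpha0 : 0 < alpha).

Let P0 : 0 < p + 1. Proof. by rewrite -ltrBlDr sub0r. Qed.

(* The substitution [r = (x^(p+1) - s^(p+1))^alpha] removes the singularity
   of the kernel: its inverse is [s = kat_inv r]. *)
Definition kat_var (s : R) : R := (x `^ (p + 1) - s `^ (p + 1)) `^ alpha.
Definition kat_inv (r : R) : R :=
  (x `^ (p + 1) - r `^ alpha^-1) `^ (p + 1)^-1.
(** On []0, x[] this is minus the derivative of [kat_var] divided by [alpha * (p + 1)]. *)
Definition kat_kernel (s : R) : R :=
  (x `^ (p + 1) - s `^ (p + 1)) `^ (alpha - 1) * s `^ p.

Lemma powR_powRV (y q : R) : 0 <= y -> q != 0 -> (y `^ q) `^ q^-1 = y.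
Proof. by move=> y0 q0; rewrite -powRrM divff// powRr1. Qed.

Lemma powRV_powR (y q : R) : 0 <= y -> q != 0 -> (y `^ q^-1) `^ q = y.
Proof. by move=> y0 q0; rewrite -powRrM mulVf// powRr1. Qed.

Lemma ltr_powR_base (q s t : R) : 0 < q -> 0 <= s -> s < t -> s `^ q < t `^ q.
Proof. by move=> q0 s0 st; rewrite gt0_ltr_powR ?nnegrE// (le_trans s0)// ltW. Qed.

Lemma ler_powR_base (q s t : R) : 0 <= q -> 0 <= s -> s <= t -> s `^ q <= t `^ q.
Proof. by move=> q0 s0 st; rewrite ge0_ler_powR ?nnegrE// (le_trans s0). Qed.

Lemma ler_powRV (q s t : R) : 0 < q -> 0 <= s -> 0 <= t ->
  s <= t `^ q -> s `^ q^-1 <= t.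
Proof.
move=> q0 s0 t0 /(ler_powR_base _ s0) h.
have q1 : 0 <= q^-1 by rewrite invr_ge0 ltW.
by have := h _ q1; rewrite powR_powRV// lt0r_neq0.
Qed.

Lemma ltr_powRV (q s t : R) : 0 < q -> 0 <= s -> 0 <= t ->
  s < t `^ q -> s `^ q^-1 < t.
Proof.
move=> q0 s0 t0 /(ltr_powR_base _ s0) h.
have q1 : 0 < q^-1 by rewrite invr_gt0.
by have := h _ q1; rewrite powR_powRV// lt0r_neq0.
Qed.

Lemma kat_var0 : kat_var 0 = (x `^ (p + 1)) `^ alpha.
Proof. by rewrite /kat_var powR0 ?subr0// lt0r_neq0. Qed.

Lemma is_derive_powR (q s : R) : 0 < s ->
  is_derive s 1 (fun t : R => t `^ q) (q * s `^ (q - 1)).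
Proof.
move=> s0; have sI : s \in `]0, +oo[ by rewrite in_itv/= s0.
apply: DeriveDef; first exact: derivable_powR.
by rewrite -derive1E powR_derive1.
Qed.

Lemma continuous_powR_base (q s : R) : 0 < s -> {for s, continuous (fun t : R => t `^ q)}.
Proof.
move=> s0; apply: differentiable_continuous; apply/derivable1_diffP.
exact: @ex_derive _ _ _ _ _ _ _ (is_derive_powR q s0).
Qed.

Lemma kat_varK s : 0 <= s -> s <= x -> kat_inv (kat_var s) = s.
Proof.
move=> s0 sx; have sx1 := ler_powR_base (ltW P0) s0 sx.
rewrite /kat_inv /kat_var powR_powRV ?subr_ge0 ?lt0r_neq0//.
by rewrite opprB addrC subrK powR_powRV// lt0r_neq0.
Qed.

(** The bound on [r] says that [r]^ alpha^-1[is at most]x [^ (p + 1)]; the base in [kat_inv] is then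
    nonnegative, where reciprocal powers cancel. *)
Lemma kat_invK r : 0 <= r -> r <= kat_var 0 -> kat_var (kat_inv r) = r.
Proof.
move=> r0; rewrite kat_var0 => /(ler_powRV alpha0 r0 (powR_ge0 _ _)) rx.
rewrite /kat_var /kat_inv powRV_powR ?subr_ge0 ?lt0r_neq0//.
by rewrite opprB addrC subrK powRV_powR// lt0r_neq0.
Qed.

Lemma kat_var_anti s t : 0 <= s -> s <= t -> t <= x -> kat_var t <= kat_var s.
Proof.
move=> s0 st tx; apply: ler_powR_base; first exact: ltW.
  by rewrite subr_ge0 ler_powR_base ?(ltW P0)// (le_trans s0).
by rewrite lerD2l lerN2 ler_powR_base// ltW.
Qed.

Lemma kat_var_anti_lt s t : 0 <= s -> s < t -> t <= x -> kat_var t < kat_var s.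
Proof.
move=> s0 st tx; apply: ltr_powR_base => //.
  by rewrite subr_ge0 ler_powR_base ?(ltW P0)// (le_trans s0)// ltW.
by rewrite ltrD2l ltrN2 ltr_powR_base.
Qed.

Lemma kat_inv_anti r r' : 0 <= r -> r <= r' -> r' <= kat_var 0 ->
  kat_inv r' <= kat_inv r.
Proof.
move=> r0 rr'; have r'0 := le_trans r0 rr'; rewrite kat_var0.
move=> /(ler_powRV alpha0 r'0 (powR_ge0 _ _)) rx.
apply: ler_powR_base; rewrite ?invr_ge0 ?(ltW P0) ?subr_ge0//.
by rewrite lerD2l lerN2 ler_powR_base// invr_ge0 ltW.
Qed.

(** [kat_inv] is nonincreasing and sends [0] to [x] and [kat_var a] to [a]. *)
Lemma kat_inv_itv a r : 0 <= a -> a <= x -> 0 <= r -> r <= kat_var a ->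
  a <= kat_inv r <= x.
Proof.
move=> a0 ax r0 ra; have x0 := le_trans a0 ax.
have va : kat_var a <= kat_var 0 by exact: kat_var_anti.
have := kat_inv_anti r0 ra va; rewrite (kat_varK a0 ax) => -> /=.
have vx : kat_var x = 0 by rewrite /kat_var subrr powR0// lt0r_neq0.
have := kat_inv_anti (lexx 0) r0 (le_trans ra va).
by rewrite -{1}vx (kat_varK x0 (lexx x)).
Qed.

Lemma is_derive_kat_var s : 0 < s -> s < x ->
  is_derive s 1 kat_var (- (alpha * (p + 1) * kat_kernel s)).
Proof.
move=> s0 sx.
have d0 : 0 < x `^ (p + 1) - s `^ (p + 1).
  by rewrite subr_gt0 ltr_powR_base// ltW.
have h1 : is_derive s 1 (fun t => x `^ (p + 1) - t `^ (p + 1))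
    (0 - (p + 1) * s `^ (p + 1 - 1)).
  by apply: is_deriveB; exact: is_derive_powR.
have h2 := is_derive_powR alpha d0.
have -> : - (alpha * (p + 1) * kat_kernel s) =
   (alpha * (x `^ (p + 1) - s `^ (p + 1)) `^ (alpha - 1)) *
   (0 - (p + 1) * s `^ (p + 1 - 1)).
  by rewrite /kat_kernel addrK; ring.
exact: (@is_derive1_comp _ (fun t => t `^ alpha) _ s _ _ h2 h1).
Qed.

Lemma continuous_kat_kernel s : 0 < s -> s < x -> {for s, continuous kat_kernel}.
Proof.
move=> s0 sx; apply: continuousM; last exact: continuous_powR_base.
have d0 : 0 < x `^ (p + 1) - s `^ (p + 1).
  by rewrite subr_gt0 ltr_powR_base// ltW.
apply: (@continuous_comp _ _ _ (fun t => x `^ (p + 1) - t `^ (p + 1))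
  (fun t => t `^ (alpha - 1))); last exact: continuous_powR_base.
by apply: continuousB; [exact: cst_continuous|exact: continuous_powR_base].
Qed.

Lemma continuous_kat_inv r : 0 < r -> r < kat_var 0 -> {for r, continuous kat_inv}.
Proof.
move=> r0 rx.
have h : 0 < x `^ (p + 1) - r `^ alpha^-1.
  by rewrite subr_gt0 ltr_powRV ?powR_ge0 ?(ltW r0)// -kat_var0.
apply: (@continuous_comp _ _ _ (fun t => x `^ (p + 1) - t `^ alpha^-1)
  (fun t => t `^ (p + 1)^-1)); last exact: continuous_powR_base.
by apply: continuousB; [exact: cst_continuous|exact: continuous_powR_base].
Qed.

Lemma derive1_kat_var s : 0 < s -> s < x ->
  derive1 kat_var s = - (alpha * (p + 1) * kat_kernel s).
Proof.
move=> s0 sx; rewrite derive1E.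
exact: (@derive_val _ _ _ _ _ _ _ (is_derive_kat_var s0 sx)).
Qed.

Lemma continuous_derive1_kat_var s : 0 < s -> s < x ->
  {for s, continuous (derive1 kat_var)}.
Proof.
move=> s0 sx; rewrite /prop_for /continuous_at derive1_kat_var//.
have : (fun t => - (alpha * (p + 1) * kat_kernel t)) t @[t --> s] -->
    - (alpha * (p + 1) * kat_kernel s).
  by apply: cvgN; apply: cvgMr; exact: continuous_kat_kernel.
apply: cvg_trans; apply: near_eq_cvg; near=> t.
rewrite derive1_kat_var//.
  by near: t; exact: lt_nbhsr.
by near: t; exact: lt_nbhsl.
Unshelve. all: by end_near. Qed.

(** Stopping at [y < x] avoids [s = x], where the kernel may blow up. On [[a, y]] the map [kat_var]
    is strictly decreasing with continuous derivative, so the limits of integration are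
    exchanged. *)
Lemma integral_kat_sub_lt (h : R -> R) a y : continuous h ->
  0 < a -> a <= y -> y < x ->
  (\int[mu]_(r in `[kat_var y, kat_var a]) (h (kat_inv r))%:E =
   \int[mu]_(s in `[a, y]) (alpha * (p + 1) * (kat_kernel s * h s))%:E)%E.
Proof.
move=> ch a0 ay yx.
have I s : s \in `[a, y] -> 0 < s /\ s < x.
  rewrite in_itv/= => /andP[as_ sy]; split; first exact: lt_le_trans as_.
  exact: le_lt_trans yx.
have Ioo s : s \in `]a, y[ -> 0 < s /\ s < x.
  by move=> sI; apply: I; exact: subset_itv_oo_cc sI.
have aI : a \in `[a, y] by rewrite in_itv/= lexx.
have yI : y \in `[a, y] by rewrite in_itv/= lexx andbT.
have cv s : s \in `[a, y] -> {for s, continuous kat_var}.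
  move=> /I[s0 sx]; apply: differentiable_continuous; apply/derivable1_diffP.
  exact: @ex_derive _ _ _ _ _ _ _ (is_derive_kat_var s0 sx).
rewrite (@integration_by_substitution_decreasing _ kat_var
  (h \o kat_inv) a y ay); first last.
(* Since [0 < kat_var y] and [kat_var a < kat_var 0], the interval stays where [kat_inv] is
   continuous. *)
- apply: continuous_in_subspaceT => r; rewrite inE/= in_itv/= => /andP[r1 r2].
  apply: continuous_comp; last exact: ch.
  have [y0 _] := I _ yI.
  apply: continuous_kat_inv.
    apply: lt_le_trans r1; apply: powR_gt0; rewrite subr_gt0.
    by rewrite ltr_powR_base// ltW.
  apply: le_lt_trans r2 _; apply: kat_var_anti_lt => //.
  by rewrite (le_trans ay)// ltW.
- split.
  + by move=> s /Ioo[s0 sx]; exact: @ex_derive _ _ _ _ _ _ _ (is_derive_kat_var s0 sx).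
  + by apply: cvg_at_right_filter; exact: cv.
  + by apply: cvg_at_left_filter; exact: cv.
- have [y0 _] := I _ yI; apply: (cvgP (derive1 kat_var y)).
  by apply: cvg_at_left_filter; exact: continuous_derive1_kat_var.
- have [_ ax] := I _ aI; apply: (cvgP (derive1 kat_var a)).
  by apply: cvg_at_right_filter; exact: continuous_derive1_kat_var.
- by move=> s /Ioo[s0 sx]; exact: continuous_derive1_kat_var.
- move=> s t /I[s0 sx] /I[t0 tx] ts; apply: kat_var_anti_lt => //; exact: ltW.
apply: eq_integral => s; rewrite inE/= => /I[s0 sx]; congr EFin.
rewrite !fctE derive1_kat_var// opprK kat_varK ?ltW//.
by rewrite mulrC mulrA.
Qed.

End Substitution.

(** * Monotonicity in the endpoint *)

Section EndpointMonotonicity.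
Context {R : realType}.
Variables (p alpha x x' : R).
Hypotheses (p1 : -1 < p) (alpha0 : 0 < alpha).

Let P0 : 0 < p + 1. Proof. by rewrite -ltrBlDr sub0r. Qed.

Lemma kat_var_mono_end s : 0 <= s -> s <= x -> x <= x' ->
  kat_var p alpha x s <= kat_var p alpha x' s.
Proof.
move=> s0 sx xx'; apply: ler_powR_base; first exact: ltW.
  by rewrite subr_ge0 ler_powR_base ?(ltW P0).
by rewrite lerD2r ler_powR_base ?(ltW P0)// (le_trans s0).
Qed.

(** At fixed [r] the base of [kat_inv] grows with [x]; hence a chain of endpoints becomes a chain of
    points at which [f] is evaluated. *)
Lemma kat_inv_mono_end a r : 0 <= a -> a <= x -> x <= x' -> 0 <= r ->
  r <= kat_var p alpha x a -> kat_inv p alpha x r <= kat_inv p alpha x' r.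
Proof.
move=> a0 ax xx' r0 ra; have x0 := le_trans a0 ax.
have := le_trans ra (kat_var_anti p1 alpha0 (lexx 0) a0 ax).
rewrite (kat_var0 _ _ p1) => /(ler_powRV alpha0 r0 (powR_ge0 _ _)) rx.
apply: ler_powR_base; rewrite ?invr_ge0 ?(ltW P0) ?subr_ge0//.
by rewrite lerD2r ler_powR_base// ltW.
Qed.

End EndpointMonotonicity.

(** * The substitution up to the singular endpoint *)

Section SubstitutionSingular.
Context {R : realType}.
Notation mu := (@lebesgue_measure R).
Variables (p alpha x : R).
Hypotheses (p1 : -1 < p) (alpha0 : 0 < alpha).
Notation kv := (kat_var p alpha x).
Notation ki := (kat_inv p alpha x).
Notation kk := (kat_kernel p alpha x).

Let P0 : 0 < p + 1. Proof. by rewrite -ltrBlDr sub0r. Qed.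

Lemma measurable_kat_inv : measurable_fun [set: R] ki.
Proof.
apply: (@measurableT_comp _ _ _ _ _ _ (fun t => t `^ (p + 1)^-1)).
  exact: measurable_powR.
by apply: measurable_funB => //; exact: measurable_powR.
Qed.

Lemma measurable_kat_kernel : measurable_fun [set: R] kk.
Proof.
apply: measurable_funM; last exact: measurable_powR.
apply: (@measurableT_comp _ _ _ _ _ _ (fun t => t `^ (alpha - 1))).
  exact: measurable_powR.
by apply: measurable_funB => //; exact: measurable_powR.
Qed.

Lemma measurable_sub_left (h : R -> R) : continuous h ->
  measurable_fun [set: R] (fun r => (h (ki r))%:E).
Proof.
move=> ch; apply/measurable_EFinP; apply: measurableT_comp.
  exact: continuous_measurable_fun.
exact: measurable_kat_inv.
Qed.

Lemma measurable_sub_right (h : R -> R) : continuous h ->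
  measurable_fun [set: R]
    (fun s => (alpha * (p + 1) * (kk s * h s))%:E).
Proof.
move=> ch; apply/measurable_EFinP; apply: measurable_funM => //.
apply: measurable_funM; first exact: measurable_kat_kernel.
exact: continuous_measurable_fun.
Qed.

Lemma kat_kernel_ge0 s : 0 <= kk s.
Proof. by rewrite mulr_ge0// powR_ge0. Qed.

Lemma sub_right_ge0 s t : 0 <= t -> 0 <= alpha * (p + 1) * (kk s * t).
Proof.
move=> t0; apply: mulr_ge0; first by rewrite ltW// mulr_gt0.
by apply: mulr_ge0 => //; exact: kat_kernel_ge0.
Qed.

(** Both sides are monotone limits: the intervals [[a, y n]] exhaust [[a, x[] and their images
    exhaust []0, kat_var a]]. Single points do not affect the integrals. *)
Lemma integral_kat_sub_ge0 (h : R -> R) (a : R) : continuous h -> (forall s, 0 <= h s) ->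
  0 < a -> a <= x ->
  (\int[mu]_(r in `[0%R, kv a]) (h (ki r))%:E =
   \int[mu]_(s in `[a, x]) (alpha * (p + 1) * (kk s * h s))%:E)%E.
Proof.
move=> ch h0 a0; rewrite le_eqVlt => /predU1P[<-|ax].
  have -> : kat_var p alpha a a = 0.
    by rewrite /kat_var subrr powR0// lt0r_neq0.
  by rewrite !set_itv1 !integral_set1.
have xa : 0 < x - a by rewrite subr_gt0.
(* This sequence starts at [a], is nondecreasing, and tends to [x] from below. *)
pose y n : R := x - (x - a) / n.+1%:R.
have ya n : a <= y n.
  rewrite lerBrDr addrC -lerBrDr ler_pdivrMr// ler_peMr ?(ltW xa)//.
  by rewrite ler1n.
have yx n : y n < x by rewrite ltrBlDr ltrDl divr_gt0.
have ymono m n : (m <= n)%N -> y m <= y n.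
  by move=> mn; rewrite lerD2l lerN2 ler_wpM2l ?(ltW xa)// lef_pV2 ?posrE// ler_nat.
have ycof s : s < x -> exists n, s <= y n.
  move=> sx; exists (Num.truncn ((x - a) / (x - s))).
  have xs : 0 < x - s by rewrite subr_gt0.
  rewrite /y lerBrDr addrC -lerBrDr ler_pdivrMr// mulrC -ler_pdivrMr//.
  have /truncn_itv/andP[_ /ltW] : 0 <= (x - a) / (x - s) by rewrite divr_ge0// ltW.
  by [].
have U1 : \bigcup_n `[a, y n]%classic = `[a, x[%classic.
  apply/seteqP; split => [s [n _]|s].
    by rewrite /= !in_itv/= => /andP[-> sy]; exact: le_lt_trans (yx n).
  rewrite /= in_itv/= => /andP[as_ /ycof[n sn]]; exists n => //=.
  by rewrite in_itv/= as_.
have U2 : \bigcup_n `[kv (y n), kv a]%classic = `]0, kv a]%classic.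
  apply/seteqP; split => [r [n _]|r].
    rewrite /= !in_itv/= => /andP[yr ->]; rewrite andbT.
    apply: lt_le_trans yr; apply: powR_gt0; rewrite subr_gt0.
    by rewrite ltr_powR_base// (le_trans (ltW a0)).
  rewrite /= in_itv/= => /andP[r0 ra].
  have r0' : r <= kv 0.
    exact: le_trans ra (kat_var_anti p1 alpha0 (lexx 0) (ltW a0) (ltW ax)).
  have /andP[ar rx] := kat_inv_itv p1 alpha0 (ltW a0) (ltW ax) (ltW r0) ra.
  have rk := kat_invK p1 alpha0 (ltW r0) r0'.
  have rx' : ki r < x.
    rewrite lt_neqAle rx andbT; apply/negP => /eqP rE.
    (* If [kat_inv r] were [x], then [r = kat_var x = 0], against [0 < r]. *)
    by move: rk; rewrite rE /kat_var subrr powR0 ?lt0r_neq0// => rE0;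
      rewrite -rE0 ltxx in r0.
  have [n yn] := ycof _ rx'; exists n => //=; rewrite in_itv/= ra andbT -rk.
  exact: (kat_var_anti p1 alpha0 (le_trans (ltW a0) ar) yn (ltW (yx n))).
have c1 : (\int[mu]_(s in `[a, y n]) (alpha * (p + 1) * (kk s * h s))%:E)%E
    @[n --> \oo] -->
    (\int[mu]_(s in `[a, x[) (alpha * (p + 1) * (kk s * h s))%:E)%E.
  rewrite -U1; apply: ge0_nondecreasing_set_cvg_integral.
  - move=> m n mn; apply/subsetPset; apply: subset_itvl; rewrite bnd_simp.
    exact: ymono.
  - by move=> n; exact: measurable_itv.
  - by move=> n; apply: measurable_funTS; exact: measurable_sub_right.
  - by move=> n s _; rewrite lee_fin sub_right_ge0.
have c2 : (\int[mu]_(r in `[kv (y n), kv a]) (h (ki r))%:E)%E @[n --> \oo] -->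
    (\int[mu]_(r in `]0%R, kv a]) (h (ki r))%:E)%E.
  rewrite -U2; apply: ge0_nondecreasing_set_cvg_integral.
  - move=> m n mn; apply/subsetPset; apply: subset_itvr; rewrite bnd_simp.
    exact: (kat_var_anti p1 alpha0 (le_trans (ltW a0) (ya m)) (ymono _ _ mn)
      (ltW (yx n))).
  - by move=> n; exact: measurable_itv.
  - by move=> n; apply: measurable_funTS; exact: measurable_sub_left.
  - by move=> n r _; rewrite lee_fin.
rewrite -[LHS]integral_itv_obnd_cbnd; last first.
  by apply: measurable_funTS; exact: (measurable_sub_left ch).
rewrite -[RHS]integral_itv_bndo_bndc; last first.
  by apply: measurable_funTS; exact: (measurable_sub_right ch).
have cE n : (\int[mu]_(r in `[kv (y n), kv a]) (h (ki r))%:E =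
   \int[mu]_(s in `[a, y n]) (alpha * (p + 1) * (kk s * h s))%:E)%E.
  exact: (integral_kat_sub_lt p1 alpha0 ch a0 (ya n) (yx n)).
rewrite (eq_cvg _ _ cE) in c2.
exact: cvg_unique c2 c1.
Qed.

(** A signed [h] is written as [(h + M) - M], a difference of nonnegative functions. Integrability
    is carried over from the [r] side, where the integrand is bounded on a bounded interval, to the
    possibly singular [s] side. *)
Lemma Rintegral_kat_sub (h : R -> R) (a M : R) : continuous h ->
  (forall s, `|h s| <= M) -> 0 < a -> a <= x ->
  mu.-integrable `[a, x] (EFin \o (fun s => kk s * h s)) /\
  Rintegral mu `[a, x] (fun s => kk s * h s) =
  (alpha * (p + 1))^-1 * Rintegral mu `[0, kv a] (fun r => h (ki r)).
Proof.
move=> ch hM a0 ax; pose ap := alpha * (p + 1).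
have ap0 : 0 < ap by rewrite mulr_gt0.
have M0 : 0 <= M by apply: le_trans (hM 0); exact: normr_ge0.
pose g s := h s + M.
have cg : continuous g by move=> s; apply: continuousD; [exact: ch|exact: cvg_cst].
have g0 s : 0 <= g s by have := hM s; rewrite ler_norml /g; lra.
have gM s : g s <= M + M by have := hM s; rewrite ler_norml /g; lra.
have cM : continuous (fun _ : R => M) by move=> s; exact: cvg_cst.
have key (u : R -> R) : continuous u -> (forall s, 0 <= u s) ->
    (forall s, u s <= M + M) ->
    mu.-integrable `[0, kv a] (EFin \o (fun r => u (ki r))) /\
    mu.-integrable `[a, x] (EFin \o (fun s => ap * (kk s * u s))) .
  move=> cu u0 uM; have i1 : mu.-integrable `[0, kv a] (EFin \o (fun r => u (ki r))).
    apply: measurable_bounded_integrable => //.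
    - by rewrite /= lebesgue_measure_itv/=; case: ifP; rewrite ?ltry// -EFinB ltry.
    - by apply: measurable_funTS; apply/measurable_EFinP; exact: measurable_sub_left.
    - exists (M + M); split; first exact: num_real.
      move=> z zM r _ /=; rewrite ger0_norm//; apply: le_trans (ltW zM); exact: uM.
  split=> //; apply/integrableP; split.
    by apply: measurable_funTS; exact: measurable_sub_right.
  have /integrableP[_] := i1.
  under eq_integral do rewrite /= ger0_norm//.
  rewrite integral_kat_sub_ge0//; apply: le_lt_trans.
  by under eq_integral do rewrite /= ger0_norm ?sub_right_ge0//.
have Rkey (u : R -> R) : continuous u -> (forall s, 0 <= u s) ->
    Rintegral mu `[0, kv a] (fun r => u (ki r)) =
    Rintegral mu `[a, x] (fun s => ap * (kk s * u s)).
  by move=> cu u0; rewrite /Rintegral integral_kat_sub_ge0.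
have [ig1 ig2] := key g cg g0 gM.
have [iM1 iM2] : mu.-integrable `[0, kv a] (EFin \o (fun r => M)) /\
    mu.-integrable `[a, x] (EFin \o (fun s => ap * (kk s * M))).
  by apply: (key (fun=> M)) => // _; rewrite lerDl.
have hE : Rintegral mu `[0, kv a] (fun r => h (ki r)) =
    Rintegral mu `[a, x] (fun s => ap * (kk s * h s)).
  transitivity (Rintegral mu `[0, kv a] (fun r => g (ki r) - M)).
    by apply: eq_Rintegral => r _; rewrite /g addrK.
  rewrite RintegralB//; [|exact: measurable_itv..].
  rewrite (Rkey g)// (Rkey (fun=> M))// -RintegralB//; [|exact: measurable_itv..].
  by apply: eq_Rintegral => s _; rewrite /g; ring.
have ih : mu.-integrable `[a, x] (EFin \o (fun s => ap * (kk s * h s))).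
  have := @integrableB _ _ _ mu _ (measurable_itv _) _ _ ig2 iM2.
  apply: eq_integrable => [|s _]; first exact: measurable_itv.
  by rewrite /= -EFinB /g; congr EFin; ring.
split.
  have := @integrableZl _ _ _ mu _ (measurable_itv _) ap^-1 _ ih.
  apply: eq_integrable => [|s _]; first exact: measurable_itv.
  by rewrite /= -EFinM mulKf// lt0r_neq0.
rewrite hE -RintegralZl//.
by apply: eq_Rintegral => s _; rewrite mulKf// lt0r_neq0.
Qed.

End SubstitutionSingular.

(** * Integrals of bounded functions over intervals *)

Section RintegralInterval.
Context {R : realType}.
Notation mu := (@lebesgue_measure R).

Lemma bounded_itv_integrable (u : R -> R) (l L M : R) :
  measurable_fun [set: R] u -> (forall r, l <= r -> r <= L -> `|u r| <= M) ->
  mu.-integrable `[l, L] (EFin \o u).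
Proof.
move=> mu_ uM; apply: measurable_bounded_integrable => //.
- by rewrite /= lebesgue_measure_itv/=; case: ifP; rewrite ?ltry// -EFinB ltry.
- exact: measurable_funTS.
- exists M; split; first exact: num_real.
  move=> z zM r /=; rewrite in_itv/= => /andP[lr rL].
  by apply: le_trans (ltW zM); exact: uM.
Qed.

Lemma Rintegral_itv_cst (L K : R) : 0 <= L ->
  Rintegral mu `[0, L] (fun=> K) = K * L.
Proof.
move=> L0; rewrite Rintegral_cst; last exact: measurable_itv.
rewrite /= lebesgue_measure_itv/= lte_fin.
case: ltP => /= [_|L0']; first by rewrite oppr0 addr0.
by have -> : L = 0 by [apply/eqP; rewrite eq_le L0' L0]; rewrite mulr0.
Qed.

Lemma Rintegral_itv_extend (u : R -> R) (l L : R) : l <= L ->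
  Rintegral mu `[0, l] u =
  Rintegral mu `[0, L] (fun r => if r <= l then u r else 0).
Proof.
move=> lL; have -> : `[0, l]%classic = `[0, L]%classic `&` [set r : R | r <= l].
  apply/seteqP; split => [r|r []]; rewrite /= !in_itv/=.
    by move=> /andP[-> rl]; split=> //; exact: le_trans lL.
  by move=> /andP[-> _] ->.
rewrite Rintegral_mkcondr; apply: eq_Rintegral => r _; rewrite patchE.
by case: ifPn => [|]; [rewrite inE/= => ->|rewrite notin_setE/= => /negP/negbTE->].
Qed.

Lemma measurable_fun_cutoff (u : R -> R) (l : R) : measurable_fun [set: R] u ->
  measurable_fun [set: R] (fun r => if r <= l then u r else 0).
Proof.
move=> mu_; apply: measurable_fun_ifT => //.
by apply: measurable_fun_ler.
Qed.

Lemma Rintegral_sum (D : set (measurableTypeR R)) (F : nat -> R -> R) m :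
  measurable D ->
  (forall i, mu.-integrable D (EFin \o F i)) ->
  mu.-integrable D (EFin \o (fun r => \sum_(0 <= i < m) F i r)) /\
  Rintegral mu D (fun r => \sum_(0 <= i < m) F i r) =
  \sum_(0 <= i < m) Rintegral mu D (F i).
Proof.
move=> mD iF; elim: m => [|m [ih1 ih2]].
  have E r : \sum_(0 <= i < 0) F i r = 0 by rewrite big_nil.
  split.
    apply: (eq_integrable mD (cst 0%E)) (integrable0 _ _) => r _.
    by rewrite /= E.
  rewrite big_nil (@eq_Rintegral _ _ _ _ _ (fun=> 0)) => [|r _]; last exact: E.
  by rewrite Rintegral_cst// mul0r.
have E r : \sum_(0 <= i < m.+1) F i r = \sum_(0 <= i < m) F i r + F m r.
  by rewrite big_nat_recr.
split.
  apply: (eq_integrable mD) (integrableD mD ih1 (iF m)) => r _.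
  by rewrite /= E.
rewrite big_nat_recr//= -ih2 -RintegralD//.
by apply: eq_Rintegral => r _; exact: E.
Qed.

(** Each increment is at most the integral of the absolute increment; summing under the integral
    leaves the pointwise bound [K]. It serves once for each variable of integration. *)
Lemma sum_increments_Rintegral (F : nat -> R -> R) m (L K : R) : 0 <= L ->
  (forall i, mu.-integrable `[0, L] (EFin \o F i)) ->
  (forall r, 0 <= r -> r <= L -> \sum_(0 <= i < m) `|F i.+1 r - F i r| <= K) ->
  \sum_(0 <= i < m)
    `|Rintegral mu `[0, L] (F i.+1) - Rintegral mu `[0, L] (F i)| <= K * L.
Proof.
move=> L0 iF hK.
have mD : measurable (`[0, L]%classic : set (measurableTypeR R)) by exact: measurable_itv.
have iD i : mu.-integrable `[0, L] (EFin \o (fun r => F i.+1 r - F i r)).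
  by apply: (eq_integrable mD) (integrableB mD (iF i.+1) (iF i)) => r _.
have iN i : mu.-integrable `[0, L] (EFin \o (fun r => `|F i.+1 r - F i r|)).
  by apply: (eq_integrable mD) (integrable_abse (iD i)) => r _.
have [iS iSE] := Rintegral_sum m mD iN.
apply: (@le_trans _ _ (\sum_(0 <= i < m)
    Rintegral mu `[0, L] (fun r => `|F i.+1 r - F i r|))).
  apply: ler_sum => i _; rewrite -RintegralB//.
  exact: le_normr_Rintegral.
rewrite -iSE.
rewrite -Rintegral_itv_cst//.
apply: le_Rintegral => //.
  by apply: (@bounded_itv_integrable _ _ _ `|K|).
by move=> r /=; rewrite in_itv/= => /andP[r0 rL]; exact: hK.
Qed.

(** Continuity under the integral sign, with the constant [M] as dominating function. *)
Lemma continuous_Rintegral_param (u : R -> R -> R) (l L M : R) :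
  (forall s, measurable_fun [set: R] (u s)) ->
  (forall r, continuous (u ^~ r)) -> (forall s r, `|u s r| <= M) ->
  continuous (fun s => Rintegral mu `[l, L] (u s)).
Proof.
move=> mu_ cu uM s.
have sI : s \in (`]s - 1, s + 1[%classic : set R).
  by rewrite inE/= in_itv/= ltrBlDr !ltrDl ltr01.
apply: (@continuity_under_integral R _ _ mu u `[l, L] _ (s - 1) (s + 1)
  _ _ (fun=> M) _ _ _ sI).
- exact: measurable_itv.
- by move=> t _; apply: (@bounded_itv_integrable _ _ _ M).
- by apply: aeW => r _ t _; exact: cu.
- by apply: (@bounded_itv_integrable _ _ _ `|M|).
- by move=> t _; apply: aeW => r _; exact: uM.
Qed.

End RintegralInterval.

(** * Continuous extension from the rectangle to the plane *)

Section Clamp.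
Context {R : realType}.
Implicit Types a b c d s t : R.

Definition clamp a b s : R := Num.max a (Num.min s b).

Lemma clamp_itv a b s : a <= b -> a <= clamp a b s <= b.
Proof. by move=> ab; rewrite /clamp le_max lexx ge_max ab ge_min lexx orbT. Qed.

Lemma clamp_id a b s : a <= s -> s <= b -> clamp a b s = s.
Proof. by move=> as_ sb; rewrite /clamp (min_idPl sb) (max_idPr as_). Qed.

Lemma clamp_dist a b s t : `|clamp a b s - clamp a b t| <= `|s - t|.
Proof.
wlog st : s t / s <= t.
  by move=> h; case/orP: (le_total s t) => [/h//|/h]; rewrite distrC [leRHS]distrC.
rewrite [leRHS]distrC [leRHS]ger0_norm ?subr_ge0// ler_norml /clamp.
case: (leP s b) => h1; case: (leP t b) => h2.
- by case: (leP a s) => h3; case: (leP a t) => h4; lra.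
- by case: (leP a s) => h3; case: (leP a b) => h4; lra.
- by case: (leP a b) => h3; case: (leP a t) => h4; lra.
- by case: (leP a b) => h3; lra.
Qed.

Lemma continuous_clamp a b : continuous (clamp a b).
Proof.
move=> s; apply/cvgrPdist_le => /= e e0.
have := @cvgrPdist_le R R^o _ (nbhs s) _ id s; move=> [/(_ (@cvg_id _ _))/(_ e e0) h _].
apply: filterS h => t; apply: le_trans; exact: clamp_dist.
Qed.

(** Lets a function continuous only within [A] be composed with a continuous map taking all its
    values in [A]. *)
Lemma cvg_within_codomain {T U : topologicalType} (A : set U) (m : T -> U) (x : T) :
  (forall y, A (m y)) -> {for x, continuous m} ->
  m y @[y --> x] --> within A (nbhs (m x)).
Proof.
move=> Am cm B hB; have h : nbhs x (fun y => A (m y) -> B (m y)) := cm _ hB.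
by apply: (filterS _ h) => y /(_ (Am y)).
Qed.

(** Composing with the retraction onto the rectangle makes [f] continuous and bounded on the whole
    plane, as the substitution lemmas demand. *)
Definition clamp_ext a b c d (f : R * R -> R) (z : R * R) : R :=
  f (clamp a b z.1, clamp c d z.2).

Lemma clamp_extE a b c d (f : R * R -> R) s t :
  a <= s -> s <= b -> c <= t -> t <= d -> clamp_ext a b c d f (s, t) = f (s, t).
Proof. by move=> as_ sb ct td; rewrite /clamp_ext !clamp_id. Qed.

Lemma continuous_clamp_ext (a b c d : R) (f : R * R -> R) : a <= b -> c <= d ->
  {within `[a, b] `*` `[c, d], continuous f} ->
  continuous (clamp_ext a b c d f).
Proof.
move=> ab cd /subspace_continuousP cf z.
have c1 : {for z, continuous (fun z : R * R => clamp a b z.1)}.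
  apply: (@continuous_comp _ _ _ fst (clamp a b)); first exact: cvg_fst.
  exact: continuous_clamp.
have c2 : {for z, continuous (fun z : R * R => clamp c d z.2)}.
  apply: (@continuous_comp _ _ _ snd (clamp c d)); first exact: cvg_snd.
  exact: continuous_clamp.
pose m (z : R * R) := (clamp a b z.1, clamp c d z.2).
have mA y : (`[a, b] `*` `[c, d])%classic (m y).
  by split; rewrite /= in_itv/= clamp_itv.
have cm : {for z, continuous m} by exact: (cvg_pair c1 c2).
have h1 := cvg_within_codomain mA cm.
have h2 := cf _ (mA z).
exact: (cvg_comp _ _ h1 h2).
Qed.

End Clamp.

(** * The Katugampola integral *)

Lemma chain_le {R : realType} (m : nat) (x : nat -> R) :
  (forall i, (i < m)%N -> x i <= x i.+1) ->
  forall i j, (i <= j)%N -> (j <= m)%N -> x i <= x j.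
Proof.
move=> xle i; elim=> [|j ih]; first by rewrite leqn0 => /eqP->.
rewrite leq_eqVlt => /predU1P[->//|ij] jm.
by apply: le_trans (xle _ jm); apply: ih => //; exact: ltnW.
Qed.

Section KatugampolaVariation.
Context {R : realType}.
Notation mu := (@lebesgue_measure R).
Variables (a b c d p q alpha beta M : R) (f : R * R -> R).
Hypotheses (a0 : 0 < a) (ab : a < b) (c0 : 0 < c) (cd : c < d).
Hypotheses (p1 : -1 < p) (q1 : -1 < q) (alpha0 : 0 < alpha) (beta0 : 0 < beta).
Hypothesis cf : {within `[a, b] `*` `[c, d], continuous f}.
Hypothesis fM : forall x y, a <= x -> x <= b -> c <= y -> y <= d ->
  `|f (x, y)| <= M.

Notation fc := (clamp_ext a b c d f).

Let cfc : continuous fc.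
Proof. exact: continuous_clamp_ext (ltW ab) (ltW cd) cf. Qed.

Let cfcl t : continuous (fun s => fc (s, t)).
Proof.
move=> s; apply: (@continuous_comp _ _ _ (fun s : R => (s, t)) fc); last exact: cfc.
apply: (@cvg_pair _ _ _ (nbhs s) (nbhs s) (nbhs t)); [exact: cvg_id|exact: cvg_cst].
Qed.

Let cfcr s : continuous (fun t => fc (s, t)).
Proof.
move=> t; apply: (@continuous_comp _ _ _ (fun t : R => (s, t)) fc); last exact: cfc.
apply: (@cvg_pair _ _ _ (nbhs t) (nbhs s) (nbhs t)); [exact: cvg_cst|exact: cvg_id].
Qed.

Let fcM z : `|fc z| <= M.
Proof.
have /andP[h1 h2] := clamp_itv z.1 (ltW ab).
by have /andP[h3 h4] := clamp_itv z.2 (ltW cd); exact: fM.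
Qed.

(** The inner integral after substitution, up to a constant. It is continuous and bounded in [s], so
    the substitution applies again in the outer variable. *)
Let inner y s :=
  Rintegral mu `[0, kat_var q beta y c] (fun r => fc (s, kat_inv q beta y r)).

Let mfcr y s : measurable_fun [set: R] (fun r => fc (s, kat_inv q beta y r)).
Proof.
apply: (@measurableT_comp _ _ _ _ _ _ (fun t => fc (s, t))).
  exact: continuous_measurable_fun.
exact: measurable_kat_inv.
Qed.

Let c_inner y : continuous (inner y).
Proof.
apply: (@continuous_Rintegral_param _ (fun s r => fc (s, kat_inv q beta y r)) _ _ M).
- by move=> s; exact: mfcr.
- by move=> r; exact: cfcl.
- by move=> s r; exact: fcM.
Qed.

Let Rintegral_bound (u : R -> R) (L : R) : 0 <= L -> measurable_fun [set: R] u ->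
  (forall r, `|u r| <= M) -> `|Rintegral mu `[0, L] u| <= M * L.
Proof.
move=> L0 mu_ uM.
have i1 : mu.-integrable `[0, L] (EFin \o u).
  by apply: (@bounded_itv_integrable _ _ _ _ M).
have mD : measurable (`[0, L]%classic : set (measurableTypeR R)) by exact: measurable_itv.
apply: le_trans (le_normr_Rintegral mD i1) _.
rewrite -Rintegral_itv_cst//.
apply: le_Rintegral => //.
- by apply: (eq_integrable mD) (integrable_abse i1) => r _.
- by apply: (@bounded_itv_integrable _ _ _ _ `|M|).
Qed.

Let inner_bound y s : `|inner y s| <= M * kat_var q beta y c.
Proof. by apply: Rintegral_bound => //; exact: powR_ge0. Qed.

Lemma katugampola_substitution x y : a <= x -> x <= b -> c <= y -> y <= d ->
  katugampola a c p q alpha beta f (x, y) =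
  ((p + 1) `^ (1 - alpha) * (q + 1) `^ (1 - beta)) / (Gamma alpha * Gamma beta) *
  ((beta * (q + 1))^-1 * ((alpha * (p + 1))^-1 *
    Rintegral mu `[0, kat_var p alpha x a] (fun r => inner y (kat_inv p alpha x r)))).
Proof.
move=> ax xb cy yd; rewrite /katugampola/=; congr (_ * _).
have [ix xE] := Rintegral_kat_sub p1 alpha0 (@c_inner y) (inner_bound y) a0 ax.
rewrite -xE -RintegralZl//.
apply: eq_Rintegral => s; rewrite inE/= in_itv/= => /andP[as_ sx].
have [iy yE] := Rintegral_kat_sub q1 beta0 (@cfcr s) (fun t => fcM (s, t)) c0 cy.
rewrite mulrCA -[X in _ = _ * X]yE -RintegralZl//.
apply: eq_Rintegral => t; rewrite inE/= in_itv/= => /andP[ct ty].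
have E (A B S T F : R) : A * B * S * T * F = A * S * (B * T * F) by ring.
by rewrite (clamp_extE f as_ (le_trans sx xb) ct (le_trans ty yd)); exact: E.
Qed.

(* The extension by [0] makes the domain of integration
   [[0, kat_var b a] * [0, kat_var d c]] independent of the endpoint [(x, y)]. *)
Let ext x y r' r := if (r' <= kat_var p alpha x a) && (r <= kat_var q beta y c)
  then fc (kat_inv p alpha x r', kat_inv q beta y r) else 0.

(** The increments are dominated by those of [W], which is [0] while [cond] fails and [V + M] once
    it holds. Then [M] pays for the jump from [0] and [V] for all later increments, and [W]
    telescopes to at most [K + M]. *)
Let ext_sum (K : R) (V : R * R -> R) (m : nat) (x y : nat -> R) r' r :
  has_variation a b c d K f V -> 0 <= r' -> 0 <= r ->
  (forall i, (i <= m)%N -> a <= x i /\ x i <= b) ->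
  (forall i, (i <= m)%N -> c <= y i /\ y i <= d) ->
  (forall i, (i < m)%N -> x i <= x i.+1) ->
  (forall i, (i < m)%N -> y i <= y i.+1) ->
  \sum_(0 <= i < m) `|ext (x i.+1) (y i.+1) r' r - ext (x i) (y i) r' r| <= K + M.
Proof.
move=> [hV1 hV2] r'0 r0 xI yI xm ym.
have M0 : 0 <= M by apply: le_trans (fcM (0, 0)); exact: normr_ge0.
pose cond i := (r' <= kat_var p alpha (x i) a) && (r <= kat_var q beta (y i) c).
pose X i := kat_inv p alpha (x i) r'; pose Y i := kat_inv q beta (y i) r.
pose W i := if cond i then V (X i, Y i) + M else 0.
have EE i : ext (x i) (y i) r' r = if cond i then fc (X i, Y i) else 0 by [].
have shift_le (u v w : R) : u - v <= (u + w) - (v + w).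
  by rewrite opprD addrACA subrr addr0.
have K0 : 0 <= K.
  by have /andP[] := hV1 a c (lexx _) (ltW ab) (lexx _) (ltW cd); exact: le_trans.
have XI i : (i <= m)%N -> cond i -> a <= X i /\ X i <= b.
  move=> im /andP[h _]; have [ax xb] := xI _ im.
  have /andP[h1 h2] := kat_inv_itv p1 alpha0 (ltW a0) ax r'0 h.
  by split=> //; exact: le_trans h2 xb.
have YI i : (i <= m)%N -> cond i -> c <= Y i /\ Y i <= d.
  move=> im /andP[_ h]; have [cy yd] := yI _ im.
  have /andP[h1 h2] := kat_inv_itv q1 beta0 (ltW c0) cy r0 h.
  by split=> //; exact: le_trans h2 yd.
have W0 i : (i <= m)%N -> 0 <= W i <= K + M.
  move=> im; rewrite /W; case: ifPn => [ci|_]; last by rewrite lexx addr_ge0.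
  have [X1 X2] := XI i im ci; have [Y1 Y2] := YI i im ci.
  by have /andP[h1 h2] := hV1 _ _ X1 X2 Y1 Y2; rewrite addr_ge0//= lerD2r.
have step i : (i < m)%N ->
    `|ext (x i.+1) (y i.+1) r' r - ext (x i) (y i) r' r| <= W i.+1 - W i.
  move=> im; have [ax xb] := xI _ (ltnW im); have [cy yd] := yI _ (ltnW im).
  rewrite (EE i) (EE i.+1) /W.
  have [ci|nci] := boolP (cond i).
    have /andP[ci1 ci2] := ci.
    (* Once true, [cond] stays true along the chain, because [kat_var] grows with its endpoint. *)
    have ci' : cond i.+1.
      apply/andP; split.
        exact: le_trans ci1 (kat_var_mono_end p1 alpha0 (ltW a0) ax (xm _ im)).
      exact: le_trans ci2 (kat_var_mono_end q1 beta0 (ltW c0) cy (ym _ im)).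
    rewrite ci'; have [X1 X2] := XI i (ltnW im) ci.
    have [X3 X4] := XI _ im ci'; have [Y1 Y2] := YI i (ltnW im) ci.
    have [Y3 Y4] := YI _ im ci'.
    have XX : X i <= X i.+1.
      exact: (kat_inv_mono_end p1 alpha0 (ltW a0) ax (xm _ im) r'0 ci1).
    have YY : Y i <= Y i.+1.
      exact: (kat_inv_mono_end q1 beta0 (ltW c0) cy (ym _ im) r0 ci2).
    have e1 := clamp_extE f X1 X2 Y1 Y2; have e2 := clamp_extE f X3 X4 Y3 Y4.
    rewrite [X in `|X - _|]e2 [X in `|_ - X|]e1.
    exact: le_trans (hV2 _ _ _ _ X1 XX X4 Y1 YY Y4) (shift_le _ _ _).
  rewrite !subr0; have [ci'|nci'] := boolP (cond i.+1); last by rewrite normr0.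
  have [X1 X2] := XI _ im ci'; have [Y1 Y2] := YI _ im ci'.
  have /andP[h1 _] := hV1 _ _ X1 X2 Y1 Y2.
  by apply: le_trans (fcM _) _; rewrite lerDr.
apply: (@le_trans _ _ (\sum_(0 <= i < m) (W i.+1 - W i))).
  by rewrite !big_nat; apply: ler_sum => i /andP[_ im]; exact: step.
rewrite telescope_sumr//.
have /andP[_ h1] := W0 m (leqnn _); have /andP[h2 _] := W0 0%N (leq0n _).
by rewrite lerBlDr (le_trans h1)// lerDl.
Qed.

Let ext_itv x y r' := Rintegral mu `[0, kat_var q beta d c] (ext x y r').

(** Here [s] replaces [kat_inv p alpha x r']. The result is continuous in [s], so composing with the
    measurable [kat_inv] shows [ext_itv] measurable. *)
Let ext_itv_cut y s := Rintegral mu `[0, kat_var q beta d c]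
  (fun r => if r <= kat_var q beta y c then fc (s, kat_inv q beta y r) else 0).

Let ext_itvE x y r' : ext_itv x y r' =
  if r' <= kat_var p alpha x a then ext_itv_cut y (kat_inv p alpha x r') else 0.
Proof.
rewrite /ext_itv /ext; case: ifPn => // _.
by rewrite Rintegral_cst ?mul0r//; exact: measurable_itv.
Qed.

Let M_ge0 : 0 <= M.
Proof. by apply: le_trans (fcM (0, 0)); exact: normr_ge0. Qed.

Let mext x y r' : measurable_fun [set: R] (ext x y r').
Proof.
rewrite /ext; case: (r' <= _) => /=; last exact: measurable_cst.
by apply: measurable_fun_cutoff; exact: mfcr.
Qed.

Let ext_bound x y r' r : `|ext x y r' r| <= M.
Proof. by rewrite /ext; case: ifP => _; [exact: fcM|rewrite normr0 M_ge0]. Qed.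

Let mext_itv x y : measurable_fun [set: R] (ext_itv x y).
Proof.
have -> : ext_itv x y = (fun r' => if r' <= kat_var p alpha x a
    then ext_itv_cut y (kat_inv p alpha x r') else 0).
  by apply/funext => r'; exact: ext_itvE.
apply: measurable_fun_cutoff; apply: measurableT_comp; last exact: measurable_kat_inv.
apply: continuous_measurable_fun.
apply: (@continuous_Rintegral_param _ (fun s r => if r <= kat_var q beta y c
  then fc (s, kat_inv q beta y r) else 0) _ _ M).
- by move=> s; apply: measurable_fun_cutoff; exact: mfcr.
- by move=> r; case: (r <= _); [exact: cfcl|move=> s; exact: cvg_cst].
- by move=> s r; case: ifP => _; [exact: fcM|rewrite normr0 M_ge0].
Qed.

Let katugampola_ext x y : a <= x -> x <= b -> c <= y -> y <= d ->
  katugampola a c p q alpha beta f (x, y) =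
  ((p + 1) `^ (1 - alpha) * (q + 1) `^ (1 - beta)) / (Gamma alpha * Gamma beta) *
  ((beta * (q + 1))^-1 * ((alpha * (p + 1))^-1 *
    Rintegral mu `[0, kat_var p alpha b a] (ext_itv x y))).
Proof.
move=> ax xb cy yd; apply: etrans (katugampola_substitution ax xb cy yd) _.
do 3 apply: congr1.
apply: etrans (Rintegral_itv_extend _
  (kat_var_mono_end p1 alpha0 (ltW a0) ax xb)) _.
apply: eq_Rintegral => r' _; apply: etrans (esym (ext_itvE x y r')).
case: (r' <= _) => //.
exact: Rintegral_itv_extend (kat_var_mono_end q1 beta0 (ltW c0) cy yd).
Qed.

(** The pointwise bound [K + M] is integrated first in [r], then in [r'], over intervals common to
    the whole chain; each integration contributes the length of its interval. *)
Lemma katugampola_arzela_BV (K : R) (V : R * R -> R) :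
  has_variation a b c d K f V ->
  arzela_BV a b c d (katugampola a c p q alpha beta f).
Proof.
move=> hV.
pose C := ((p + 1) `^ (1 - alpha) * (q + 1) `^ (1 - beta)) /
  (Gamma alpha * Gamma beta) * ((beta * (q + 1))^-1 * (alpha * (p + 1))^-1).
exists (`|C| * ((K + M) * kat_var q beta d c * kat_var p alpha b a)).
move=> m x y x0 xm y0 ym xle yle.
have xI i : (i <= m)%N -> a <= x i /\ x i <= b.
  move=> im; rewrite -x0 -xm.
  by split; [exact: chain_le xle _ _ (leq0n _) im|exact: chain_le xle _ _ im _].
have yI i : (i <= m)%N -> c <= y i /\ y i <= d.
  move=> im; rewrite -y0 -ym.
  by split; [exact: chain_le yle _ _ (leq0n _) im|exact: chain_le yle _ _ im _].
pose F i := ext_itv (x i) (y i).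
have assoc4 (t u v w : R) : t * (u * (v * w)) = t * (u * v) * w.
  by rewrite !mulrA.
have gE i : (i <= m)%N -> katugampola a c p q alpha beta f (x i, y i) =
    C * Rintegral mu `[0, kat_var p alpha b a] (F i).
  move=> im; have [ax xb] := xI _ im; have [cy yd] := yI _ im.
  by apply: etrans (katugampola_ext ax xb cy yd) _; exact: assoc4.
rewrite (@eq_big_nat _ _ _ _ _ _ (fun i => `|C| *
  `|Rintegral mu `[0, kat_var p alpha b a] (F i.+1) -
    Rintegral mu `[0, kat_var p alpha b a] (F i)|)); last first.
  by move=> i /andP[_ im]; rewrite !gE ?(ltnW im)// -mulrBr normrM.
rewrite -mulr_sumr ler_wpM2l//.
apply: sum_increments_Rintegral; first exact: powR_ge0.
  move=> i; apply: (@bounded_itv_integrable _ _ _ _ (M * kat_var q beta d c)).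
    exact: mext_itv.
  move=> r' _ _; apply: Rintegral_bound; first exact: powR_ge0.
    exact: mext.
  exact: ext_bound.
move=> r' r'0 _.
apply: (sum_increments_Rintegral (F := fun i => ext (x i) (y i) r')).
- exact: powR_ge0.
- move=> i; apply: (@bounded_itv_integrable _ _ _ _ M); first exact: mext.
  by move=> r _ _; exact: ext_bound.
- by move=> r r0 _; exact: (ext_sum hV r'0 r0 xI yI xle yle).
Qed.

End KatugampolaVariation.

Theorem mainTheorem5 (R : realType) (a b c d p q alpha beta : R)
  (f : R * R -> R) :
  0 < a -> a < b -> 0 < c -> c < d -> -1 < p -> -1 < q ->
  0 < alpha -> 0 < beta ->
  {within `[a, b] `*` `[c, d], continuous f} ->
  arzela_BV a b c d f ->
  let G := graph3 a b c d (katugampola a c p q alpha beta f) in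
  boxdim_is G 2 /\ dimH G = 2%:E.
Proof.
move=> a0 ab c0 cd p1 q1 alpha0 beta0 cf bvf G.
have [K [V hV]] := arzela_BV_variation (ltW ab) (ltW cd) bvf.
have [M fM] := has_variation_bounded (ltW ab) (ltW cd) hV.
(* The integral has its own variation function, to which the covering estimates apply. *)
have [K' [V' hV']] := arzela_BV_variation (ltW ab) (ltW cd)
  (katugampola_arzela_BV a0 ab c0 cd p1 q1 alpha0 beta0 cf fM hV).
by split; [exact: boxdim_graph hV'|exact: dimH_graph hV'].
Qed.
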